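(* Assume that $\operatorname{cov}(\mathcal{M})=\operatorname{cof}(\mathcal{M})$ and that the cardinal number $\operatorname{cov}(\mathcal{M})$ is regular. Then there are $\operatorname{cov}(\mathcal{M})$-Luzin sets $X,Y\subseteq[\mathbb{N}]^{\infty}$ such that: (1) all finite powers of $X$ and all finite powers of $Y$ are Rothberger; (2) the product space $X\times Y$ is not Menger; (3) the union $X\cup Y$ is $2$-dominating.
   Context: $\mathbb{N}=\{1,2,\dots\}$. The power set $P(\mathbb{N})$ is identified with the Cantor cube $\{0,1\}^{\mathbb{N}}$ via characteristic functions and carries its topology. $[\mathbb{N}]^{\infty}$ is the set of all infinite subsets of $\mathbb{N}$ with the subspace topology; each $a\in[\mathbb{N}]^{\infty}$ is identified with its increasing enumeration, so $a(n)$ is the $n$-th smallest element of $a$ (this gives $[\mathbb{N}]^{\infty}\subseteq\mathbb{N}^{\mathbb{N}}$, with the same topology). $\operatorname{cov}(\mathcal{M})$ is the minimal cardinality of a family of meager subsets of $\mathbb{R}$ that covers $\mathbb{R}$; $\operatorname{cof}(\mathcal{M})$ is the minimal cardinality of a family of meager subsets of $\mathbb{R}$ such that every meager subset of $\mathbb{R}$ is contained in a member of the family (replacing $\mathbb{R}$ by $P(\mathbb{N})$ gives the same cardinals). A set $X\subseteq[\mathbb{N}]^{\infty}$ is a $\operatorname{cov}(\mathcal{M})$-Luzin set if $|X|\ge\operatorname{cov}(\mathcal{M})$ and $|X\cap M|<\operatorname{cov}(\mathcal{M})$ for every meager set $M\subseteq P(\mathbb{N})$. A space $X$ is Rothberger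 if for every sequence $\mathcal{U}_1,\mathcal{U}_2,\dots$ of open covers of $X$ there are $U_1\in\mathcal{U}_1,U_2\in\mathcal{U}_2,\dots$ such that $\{U_n:n\in\mathbb{N}\}$ covers $X$. A space $X$ is Menger if for every sequence $\mathcal{U}_1,\mathcal{U}_2,\dots$ of open covers of $X$ there are finite $\mathcal{F}_1\subseteq\mathcal{U}_1,\mathcal{F}_2\subseteq\mathcal{U}_2,\dots$ such that $\bigcup_n\mathcal{F}_n$ covers $X$. For $x,y\in[\mathbb{N}]^{\infty}$, $x\le^* y$ means that $\{n: y(n)<x(n)\}$ is finite, and $\max\{x,y\}\in[\mathbb{N}]^{\infty}$ is given by $\max\{x,y\}(n)=\max\{x(n),y(n)\}$. A set $D\subseteq[\mathbb{N}]^{\infty}$ is dominating if for every $x\in[\mathbb{N}]^{\infty}$ there is $d\in D$ with $x\le^* d$. A set $X\subseteq[\mathbb{N}]^{\infty}$ is $2$-dominating if $\{\max\{x,y\}:x,y\in X\}$ is dominating. *)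

(* Defs.v *)
From HB Require Import structures.
From mathcomp Require Import all_boot all_order all_algebra.
From mathcomp Require Import boolp classical_sets functions cardinality.
From mathcomp Require Import reals topology normedtype cantor.
Import numFieldNormedType.Exports.

Set Implicit Arguments.
Unset Strict Implicit.
Unset Printing Implicit Defensive.

Local Open Scope classical_set_scope.
Local Open Scope card_scope.

Definition card_lt (T U : Type) (A : set T) (B : set U) : Prop :=
  A #<= B /\ ~ (B #<= A).

(* Cardinal numbers are represented by sets, up to [#=]; index sets of size
   less than [K] can be taken inside the ambient type of [K]. *)
Definition regular_card (T : Type) (K : set T) : Prop :=
  infinite_set K /\
  forall (I : set T) (A : T -> set T),
    card_lt I K -> (forall i, I i -> card_lt (A i) K) ->
    card_lt (\bigcup_(i in I) A i) K.

Definition least_card (T : Type) (P : set (set T)) : set (set T) :=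
  [set F | P F /\ forall G, P G -> F #<= G].

(* Hence the minimum cardinality of the members of [P] is well defined. *)
Lemma least_card_exists (T : Type) (P : set (set T)) :
  P !=set0 -> least_card P !=set0.
Proof.
move=> [E PE].
pose Q (Z : set (set T -> T)) :=
  (forall g F, Z g -> P F -> F (g F)) /\
  (forall g h F, Z g -> Z h -> P F -> g F = h F -> g = h).
have [|Z [[Zsec Zinj] Zmax]] := @Zorn_bigcup _ Q.
  move=> C CQ Ctot; split.
    by move=> g F [Z CZ Zg] PF; exact: (CQ _ CZ).1 g F Zg PF.
  move=> g h F [Z CZ Zg] [Z' CZ' Z'h] PF.
  have [ZZ'|Z'Z] := Ctot _ _ CZ CZ'.
    by have [_ /(_ g h F)] := CQ _ CZ'; apply=> //; exact: ZZ'.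
  by have [_ /(_ g h F)] := CQ _ CZ; apply=> //; exact: Z'Z.
have [F0 PF0 F0Z] : exists2 F, P F & F `<=` (fun g => g F) @` Z.
  apply: contrapT => noF.
  have new F : P F -> exists2 t, F t & forall g, Z g -> g F <> t.
    move=> PF; apply: contrapT => not; apply: noF; exists F => // t Ft.
    apply: contrapT => nt; apply: not; exists t => // g Zg gt.
    by apply: nt; exists g.
  have [t0 _ _] := new _ PE.
  have /choice[f fP] : forall F, exists t,
      P F -> F t /\ forall g, Z g -> g F <> t.
    move=> F; have [PF|nPF] := pselect (P F); last by exists t0.
    by have [t Ft gt] := new _ PF; exists t.
  have nZf : ~ Z f by move=> Zf; have [_ /(_ _ Zf)] := fP _ PE; apply.
  apply: (Zmax (Z `|` [set f])).
    by split=> [g|ZfZ]; [left|apply/nZf/(ZfZ f); right].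
  split=> [g F [Zg|->] PF|g h F [Zg|->] [Zh|->] PF gh //].
  - exact: Zsec g F Zg PF.
  - by have [] := fP _ PF.
  - exact: (Zinj g h F).
  - by have [_ /(_ _ Zg)] := fP _ PF; rewrite gh.
  - by have [_ /(_ _ Zh)] := fP _ PF; rewrite -gh.
exists F0; split=> // G PG.
apply: (@card_le_trans _ _ _ Z).
  apply: (card_le_trans (subset_card_le F0Z)).
  exact: card_image_le.
have Zg : set_inj Z (fun g => g G).
  by move=> g h /set_mem Zg /set_mem Zh; apply: Zinj.
rewrite -(card_le_eql (inj_card_eq Zg)).
by apply: subset_card_le => _ [g Zg' <-]; exact: Zsec g G Zg' PG.
Qed.

Definition nowhere_dense (T : topologicalType) (A : set T) : Prop :=
  interior (closure A) = set0.

Definition meager (T : topologicalType) (M : set T) : Prop :=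
  exists2 A : nat -> set T, (forall n, nowhere_dense (A n)) & M = \bigcup_n A n.

Definition meager_cover (T : topologicalType) : set (set (set T)) :=
  [set F | F `<=` @meager T /\ \bigcup_(M in F) M = [set: T]].

Definition meager_cofinal (T : topologicalType) : set (set (set T)) :=
  [set F | F `<=` @meager T /\
           forall M, meager M -> exists2 N, F N & M `<=` N].

(* The cardinals cov(M) and cof(M), each represented by a witnessing family of
   meager sets of least cardinality. *)
Definition cov_meager (R : realType) : set (set R) :=
  xget set0 (least_card (@meager_cover R)).

Definition cof_meager (R : realType) : set (set R) :=
  xget set0 (least_card (@meager_cofinal R)).

Arguments cov_meager : clear implicits.
Arguments cof_meager : clear implicits.

Lemma cov_meagerP (R : realType) :
  meager_cover (cov_meager R) /\
  forall F : set (set R), meager_cover F -> cov_meager R #<= F.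
Proof.
have [|F leF] := @least_card_exists _ (@meager_cover R); last first.
  exact: (xgetPex set0 (ex_intro _ F leF)).
exists [set [set x] | x in [set: R]]; split=> [_ [x _ <-]|].
  exists (fun=> [set x]) => [_|].
    rewrite /nowhere_dense -(closure_id [set x]).1; last first.
      by apply: accessible_closed_set1; exact/hausdorff_accessible/Rhausdorff.
    rewrite -subset0 => y xy.
    have [z [/interior_subset zx /(_ zx)]//] :=
      @dense_set1C R x _ (ex_intro _ y xy) (open_interior _).
  by rewrite bigcup_const//; exists 0%N.
by rewrite predeqE => x; split=> // _; exists [set x] => //; exists x.
Qed.

Lemma cof_meagerP (R : realType) :
  meager_cofinal (cof_meager R) /\
  forall F : set (set R), meager_cofinal F -> cof_meager R #<= F.
Proof.
have [|F leF] := @least_card_exists _ (@meager_cofinal R); last first.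
  exact: (xgetPex set0 (ex_intro _ F leF)).
by exists (@meager R); split=> // M mM; exists M.
Qed.

Definition open_cover (T : topologicalType) (U : set (set T)) : Prop :=
  U `<=` open /\ \bigcup_(A in U) A = [set: T].

Definition rothberger (T : topologicalType) : Prop :=
  forall U : nat -> set (set T), (forall n, open_cover (U n)) ->
  exists2 V : nat -> set T,
    (forall n, U n (V n)) & \bigcup_n V n = [set: T].

Definition menger (T : topologicalType) : Prop :=
  forall U : nat -> set (set T), (forall n, open_cover (U n)) ->
  exists2 F : nat -> set (set T),
    (forall n, finite_set (F n) /\ F n `<=` U n) &
    \bigcup_n \bigcup_(A in F n) A = [set: T].

Implicit Types (x y a : cantor_space) (X D : set cantor_space).

(* A point of [cantor_space] is the characteristic function of a subset of
   [nat]; positive integers are shifted by one, and enumerations start at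
   index 0. *)
Definition infinite_subsets : set cantor_space :=
  [set a : cantor_space | infinite_set [set k : nat | a k]].

(* The element of [a] with exactly [n] elements of [a] below it; the default
   value 0 never occurs when [a] is infinite. *)
Definition nth_elt a (n : nat) : nat :=
  xget 0%N [set k : nat | a k /\ count a (iota 0 k) = n].

Lemma nth_eltP a n : infinite_subsets a ->
  a (nth_elt a n) /\ count a (iota 0 (nth_elt a n)) = n.
Proof.
move=> ainf; pose c k := count a (iota 0 k).
have cS k : c k.+1 = (c k + a k)%N.
  by rewrite /c -addn1 iotaD count_cat /= add0n addn0.
have unb m : exists2 k, (m <= k)%N & a k.
  apply: contrapT => nok; apply: ainf.
  apply: (@sub_finite_set _ _ `I_m); last exact: finite_II.
  move=> k /= ak; rewrite ltnNge; apply/negP => mk; apply: nok.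
  by exists k.
have cle k m : (c k <= c (k + m))%N.
  by elim: m => [|m IHm]; rewrite ?addn0// addnS cS (leq_trans IHm)// leq_addr.
have cunb : exists k, (n < c k)%N.
  elim: n => [|m [k mk]].
    by have [k _ ak] := unb 0%N; exists k.+1; rewrite cS ak addn1.
  have [k' kk' ak'] := unb k; exists k'.+1; rewrite cS ak' addn1 ltnS.
  by rewrite (leq_trans mk)// -(subnKC kk') cle.
suff ex : exists k, [set k | a k /\ c k = n] k by exact: (xgetPex 0%N ex).
case: (ex_minnP cunb) => -[|k] //; rewrite cS => nk kmin.
have ckn : (c k <= n)%N by rewrite leqNgt; apply/negP => /kmin; rewrite ltnn.
exists k; rewrite /=; case: (a k) nk => nk.
  by split=> //; apply/eqP; rewrite eqn_leq ckn; move: nk; rewrite addn1.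
by move: nk; rewrite addn0 ltnNge ckn.
Qed.

Lemma nth_elt_mono a m n : infinite_subsets a ->
  (m < n)%N -> (nth_elt a m < nth_elt a n)%N.
Proof.
move=> ainf; rewrite !ltnNge; apply: contra => le.
rewrite -[leqLHS](nth_eltP n ainf).2 -[leqRHS](nth_eltP m ainf).2.
by rewrite -(subnKC le) iotaD count_cat leq_addr.
Qed.

(* [nth_elt a] is the only increasing enumeration of [a]. *)
Lemma nth_elt_unique (f : nat -> nat) a : {homo f : m n / (m < n)%N} ->
  (forall k, a k <-> exists n, k = f n) -> nth_elt a =1 f.
Proof.
move=> fhomo af n.
have fmono : {mono f : m n / (m < n)%N}.
  move=> p q; apply/idP/idP => [|/fhomo//]; apply: contraTT.
  rewrite -2!leqNgt leq_eqVlt => /predU1P[->//|/fhomo]; exact: ltnW.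
have cf p : count a (iota 0 (f p)) = p.
  rewrite -size_filter -[RHS](size_iota 0) -(size_map f (iota 0 p)).
  apply: perm_size; apply: uniq_perm.
  - by rewrite filter_uniq// iota_uniq.
  - rewrite map_inj_uniq ?iota_uniq// => q r qr.
    by case: (ltngtP q r) => // /fhomo; rewrite qr ltnn.
  move=> k; rewrite mem_filter mem_iota/= add0n; apply/andP/mapP.
    by move=> [/af[q ->]]; rewrite fmono => qp; exists q; rewrite ?mem_iota.
  move=> [q]; rewrite mem_iota/= add0n => qp ->; rewrite fmono; split=> //.
  by apply/af; exists q.
apply: xget_unique => [|k' [/af[p ->]]]; last by rewrite cf => ->.
by split; [apply/af; exists n|exact: cf].
Qed.

Definition le_star x y : Prop :=
  finite_set [set n | (nth_elt y n < nth_elt x n)%N].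

Definition max_subset x y : cantor_space :=
  fun k => `[< exists n, k = maxn (nth_elt x n) (nth_elt y n) >].

Lemma nth_elt_max x y : infinite_subsets x -> infinite_subsets y ->
  forall n, nth_elt (max_subset x y) n = maxn (nth_elt x n) (nth_elt y n).
Proof.
move=> xinf yinf; apply: nth_elt_unique => [m n mn|k]; last by split=> /asboolP.
by rewrite -maxnSS geq_max !leq_max !nth_elt_mono ?orbT.
Qed.

Definition dominating D : Prop :=
  forall x, infinite_subsets x -> exists2 d, D d & le_star x d.

Definition two_dominating X : Prop :=
  dominating [set max_subset x y | x in X & y in X].

Definition luzin (T : Type) (K : set T) X : Prop :=
  [/\ X `<=` infinite_subsets,
      K #<= X &
      forall M : set cantor_space, meager M -> card_lt (X `&` M) K].

(* Main.v *)
Require Import Defs.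
From mathcomp Require Import all_boot all_order all_algebra.
From mathcomp Require Import boolp classical_sets functions cardinality.
From mathcomp Require Import reals topology normedtype cantor.
From mathcomp Require Import wochoice zify lra.
Import Order.TTheory GRing.Theory Num.Theory numFieldNormedType.Exports.

Set Implicit Arguments.
Unset Strict Implicit.
Unset Printing Implicit Defensive.

Local Open Scope classical_set_scope.
Local Open Scope card_scope.

(** Let [K = cov(M) = cof(M)] be regular and index everything by a well-order
    of type [K]. Binary digits turn a cofinal family of meager sets of reals
    into countable families [T a] of dense open sets of the Cantor space such
    that every dense open set contains some [\bigcap_m T a m], and turn
    [K = cov(M)] into the existence of points generic for any fewer than [K]
    dense open sets. The families [T a] yield a dominating family [d a].

    By recursion on [a] one chooses [x a] and [y a] such that
    [max(x a, y a) >= d a] and such that, for [b < a], all sections of the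
    [T b m] at finitely many earlier points that are dense stay dense after a
    further section at [x a] (or [y a]). So a tuple with increasing indices
    above [b] lies in no meager set coded by [b]; for tuples of length one this
    is the Luzin property.

    Finite powers are Rothberger by induction on the length of the tuple,
    selecting simultaneously for fewer than [K] sequences of covers: half of
    the covers take care of a countable dense set, hence of all tuples with
    indices above some [b]; a remaining tuple has its least index in a set of
    size less than [K], and fixing that coordinate decreases the length. *)

(** * Cardinalities below a regular cardinal *)

(** Zorn's lemma gives a maximal graph [Z] of a partial injection from [A] to [B]; if it missed a
    point on both sides, that pair could be added. *)
Lemma card_le_total T U (A : set T) (B : set U) : A #<= B \/ B #<= A.
Proof.
pose Q (Z : set (T * U)) := [/\ Z `<=` A `*` B,
  (forall p q, Z p -> Z q -> p.1 = q.1 -> p = q) &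
  (forall p q, Z p -> Z q -> p.2 = q.2 -> p = q)].
have [|Z [[ZAB Z1 Z2] Zmax]] := @Zorn_bigcup _ Q.
  move=> C CQ Ctot.
  have common p q X Y : C X -> C Y -> X p -> Y q -> exists2 W, C W & W p /\ W q.
    move=> CX CY Xp Yq; have [XY|YX] := Ctot _ _ CX CY.
      by exists Y => //; split=> //; exact: XY.
    by exists X => //; split=> //; exact: YX.
  split=> [p [X CX Xp]|p q [X CX Xp] [Y CY Yq]|p q [X CX Xp] [Y CY Yq]].
  - by have [/(_ p Xp)] := CQ _ CX.
  - have [W CW [Wp Wq]] := common _ _ _ _ CX CY Xp Yq.
    by have [_ + _] := CQ _ CW; exact.
  - have [W CW [Wp Wq]] := common _ _ _ _ CX CY Xp Yq.
    by have [_ _] := CQ _ CW; exact.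
have ZE1 : fst @` Z #= Z.
  by apply: inj_card_eq => p q /set_mem Zp /set_mem Zq; exact: Z1.
have ZE2 : snd @` Z #= Z.
  by apply: inj_card_eq => p q /set_mem Zp /set_mem Zq; exact: Z2.
have sub1 : fst @` Z `<=` A by move=> _ [p /ZAB[Ap _] <-].
have sub2 : snd @` Z `<=` B by move=> _ [p /ZAB[_ Bp] <-].
have [AZ|/existsNP[a /not_implyP[Aa Za]]] := pselect (A `<=` fst @` Z).
  left; apply: (card_le_trans (subset_card_le AZ)).
  by rewrite (card_le_eql ZE1) -(card_le_eql ZE2) subset_card_le.
have [BZ|/existsNP[b /not_implyP[Bb Zb]]] := pselect (B `<=` snd @` Z).
  right; apply: (card_le_trans (subset_card_le BZ)).
  by rewrite (card_le_eql ZE2) -(card_le_eql ZE1) subset_card_le.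
exfalso; apply: (Zmax (Z `|` [set (a, b)])).
  split=> [p Zp|ZZ]; first by left.
  by apply: Za; exists (a, b) => //; apply: ZZ; right.
split=> [p [/ZAB//|->//]|p q|p q].
  move=> [Zp|->] [Zq|->] //=; first exact: Z1.
    by move=> pa; case: Za; exists p.
  by move=> pa; case: Za; exists q.
move=> [Zp|->] [Zq|->] //=; first exact: Z2.
  by move=> pb; case: Zb; exists p.
by move=> pb; case: Zb; exists q.
Qed.

(** As cardinals are comparable, this says that [A] has cardinality strictly below that of [K]; the
    negative form makes monotonicity immediate and lets [A] live in any type. *)
Definition small T (K : set T) U (A : set U) := ~ (K #<= A).

Section Small.
Variables (T : pointedType) (K : set T).
Hypothesis Kreg : regular_card K.

Lemma small_card_le U V (A : set U) (B : set V) :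
  A #<= B -> small K B -> small K A.
Proof. by move=> AB sB KA; apply: sB; exact: card_le_trans AB. Qed.

Lemma small_sub U (A B : set U) : A `<=` B -> small K B -> small K A.
Proof. by move=> AB; apply: small_card_le; exact: subset_card_le. Qed.

Lemma small_image U V (f : U -> V) (A : set U) : small K A -> small K (f @` A).
Proof. by apply: small_card_le; exact: card_image_le. Qed.

(** Regularity speaks only of index sets and members inside [T]. A surjection [g] of the union onto
    [K] and an injection [f] of [I] into [K] carry the family to such a one, whose union would be
    all of [K]. *)
Lemma small_bigcup U V (I : set U) (A : U -> set V) :
  small K I -> (forall i, I i -> small K (A i)) ->
  small K (\bigcup_(i in I) A i).
Proof.
move=> sI sA /pcard_surjP[g gsurj].
have [IK|/sI//] := card_le_total I K.
have /pcard_leP[f] := IK.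
pose A' (j : T) := [set t | K t /\ exists i v, [/\ I i, f i = j, A i v & g v = t]].
have [_ /(_ (f @` I) A')] := Kreg; case.
- split; last exact: small_image.
  by apply: subset_card_le => _ [i Ii <-]; exact: funS.
- move=> _ [i Ii <-]; split; first by apply: subset_card_le => t [].
  apply: (@small_sub _ _ (g @` A i)); last exact/small_image/sA.
  move=> t [_ [j [v [Ij fji Ajv <-]]]]; exists v => //.
  by rewrite -[i](@inj _ _ _ f j)//; apply/mem_set.
- move=> _; apply; apply: subset_card_le => t /[dup] Kt /gsurj[v [i Ii Aiv] gvt].
  by exists (f i) => //; split=> //; exists i, v.
Qed.

Lemma small_finite U (A : set U) : finite_set A -> small K A.
Proof. by have [Kinf _] := Kreg; move=> fA /card_le_finite/(_ fA). Qed.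

Hypothesis Kuncount : small K [set: nat].

Lemma small_countable U (A : set U) : countable A -> small K A.
Proof. by move=> /small_card_le; apply. Qed.

Lemma small_countType (U : countType) (A : set U) : small K A.
Proof. exact/small_countable/countableP. Qed.

Lemma smallU U (A B : set U) : small K A -> small K B -> small K (A `|` B).
Proof.
move=> sA sB; rewrite (_ : A `|` B = \bigcup_b (if b then A else B)).
  by apply: small_bigcup => [|[]]; first exact: small_countType.
rewrite predeqE => u; split=> [[Au|Bu]|[[] _ ?]].
- by exists true.
- by exists false.
- by left.
- by right.
Qed.

Lemma smallX U V (A : set U) (B : set V) :
  small K A -> small K B -> small K (A `*` B).
Proof.
move=> sA sB.
apply: (@small_sub _ _ (\bigcup_(a in A) (pair a @` B))).
  by move=> [a b] [/= Aa Bb]; exists a => //; exists b.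
by apply: small_bigcup => // a _; exact: small_image.
Qed.

Lemma small_seq (U : eqType) (A : set U) :
  small K A -> small K [set s : seq U | forall a, a \in s -> A a].
Proof.
move=> sA; set S := [set s | _].
pose L n := [set s | S s /\ size s = n].
apply: (@small_sub _ _ (\bigcup_n L n)); first by move=> s Ss; exists (size s).
apply: small_bigcup => [|n _]; first exact: small_countType.
elim: n => [|n IHn].
  apply: (@small_sub _ _ [set [::]]); last exact/small_finite/finite_set1.
  by move=> s [_ /size0nil].
apply: (@small_sub _ _ ((fun p => p.1 :: p.2) @` (A `*` L n))).
  move=> [[]//|a s] [Ss [sz]]; exists (a, s) => //=; split=> /=.
    by apply: Ss; rewrite mem_head.
  by split=> // b bs; apply: Ss; rewrite in_cons bs orbT.
by apply: small_image; exact: smallX.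
Qed.

End Small.

Lemma well_order_exists (T : Type) : exists lt : T -> T -> Prop,
  [/\ well_founded lt, (forall a b c, lt a b -> lt b c -> lt a c) &
      (forall a b, [\/ lt a b, a = b | lt b a])].
Proof.
elim/Peq: T => T.
have [le lewo] := well_ordering_principle T.
have lewoc : wo_chain le predT by move=> A _; exact: lewo.
have lerefl x : le x x by exact: (wo_chain_reflexive lewoc).
have leanti x y : le x y -> le y x -> x = y.
  by move=> xy yx; apply: (wo_chain_antisymmetric lewoc) => //; rewrite xy yx.
have least (A : set T) : A !=set0 -> exists2 z, A z & forall x, A x -> le z x.
  move=> [a Aa]; have [|z [[zA zmin] _]] := lewo [pred x | `[< A x >]].
    by exists a; apply/asboolP.
  exists z; first exact/asboolP.
  by move=> x Ax; apply: zmin; exact/asboolP.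
have letot x y : le x y \/ le y x.
  have [|z [->|->] zm] := least [set x; y]; first by exists x; left.
    by left; apply: zm; right.
  by right; apply: zm; left.
exists (fun a b => le a b /\ a <> b); split.
- move=> a; apply: contrapT => na.
  have [|z /= nz zm] := least [set x | ~ Acc (fun a b => le a b /\ a <> b) x].
    by exists a.
  apply: nz; constructor=> y [yz ne]; apply: contrapT => ny.
  by apply: ne; apply: leanti => //; exact: zm.
- move=> a b c [ab nab] [bc nbc].
  have [z zabc zm] := least [set a; b; c] (ex_intro _ a (or_introl (or_introl erefl))).
  have za : le z a by apply: zm; left; left.
  have zb : le z b by apply: zm; left; right.
  have zc : le z c by apply: zm; right.
  case: zabc => [[|]|] /= ?; subst z.
  + split=> // ac; subst c; exact/nab/leanti.
  + by case: nab; exact: leanti.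
  + by case: nbc; exact: leanti.
- move=> a b; have [->|ne] := pselect (a = b); first exact: Or32.
  have [ab|ba] := letot a b; first exact: Or31.
  by apply: Or33; split=> // /esym.
Qed.

(** The order is that of an initial ordinal. It lives on the points of [K] with few predecessors in
    [K]: if some point of [K] fails this, the predecessors of the least such point all qualify and
    are already as many as [K]. *)
Lemma initial_index (T : pointedType) (K : set T) :
  exists (A : choiceType) (lt : rel A),
  [/\ well_founded lt, transitive lt,
      (forall a b, [\/ lt a b, a = b | lt b a]),
      (forall a, small K [set b | lt b a]) & [set: A] #= K].
Proof.
have [lt [ltwf lttr lttri]] := well_order_exists T.
pose D := [set x | K x /\ small K [set y | K y /\ lt y x]].
have DK : K #<= D.
  have [KD|/existsNP[a /not_implyP[Ka Da]]] := pselect (K `<=` D).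
    exact: subset_card_le.
  elim/(well_founded_ind ltwf): a Ka Da => a IH Ka Da.
  have [[b [Kb Db ba]]|nb] := pselect (exists b, [/\ K b, ~ D b & lt b a]).
    exact: IH ba Kb Db.
  have /contrapT Ka' : ~ small K [set y | K y /\ lt y a] by move=> sa; apply: Da.
  apply: (card_le_trans Ka'); apply: subset_card_le => y [Ky ya].
  by apply: contrapT => nDy; apply: nb; exists y.
exists (set_type D), (fun a b => `[< lt (val a) (val b) >]); split.
- suff acc x (a : D) : val a = x -> Acc (fun a b : D => `[< lt (val a) (val b) >]) a.
    by move=> a; exact: acc.
  elim/(well_founded_ind ltwf): x a => x IH a ax; constructor=> b /asboolP ba.
  by apply: IH erefl; rewrite -ax.
- by move=> a b c /asboolP ba /asboolP bc; apply/asboolP; exact: lttr bc.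
- move=> a b; have [ab|/val_inj ab|ab] := lttri (val a) (val b).
  + by apply: Or31; exact/asboolP.
  + exact: Or32.
  + by apply: Or33; exact/asboolP.
- move=> a; have [_ +] : D (val a) by exact: set_valP.
  apply: small_card_le; set I := [set b : D | _].
  have IE : val @` I #= I by apply: inj_card_eq => b c _ _; exact: val_inj.
  rewrite -(card_le_eql IE); apply: subset_card_le => _ [b /asboolP ba <-].
  by split=> //; have [] : D (val b) by exact: set_valP.
- rewrite (card_eql (card_setT D)) card_eq_le DK andbT.
  by apply: subset_card_le => x [].
Qed.

(** * From the real line to sequences *)

Section Baire_sequences.
Variable Q : Type.
Implicit Types (c : nat -> Q) (D E : set (nat -> Q)).

Definition agree (n : nat) c c' := forall i, (i < n)%N -> c i = c' i.

Definition seq_open D := forall c, D c -> exists n, forall c', agree n c c' -> D c'.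

Definition seq_dense D := forall c n, exists2 c', agree n c c' & D c'.

Lemma agree_sym n c c' : agree n c c' -> agree n c' c.
Proof. by move=> cc' i /cc'. Qed.

Lemma agree_trans n c c' c'' : agree n c c' -> agree n c' c'' -> agree n c c''.
Proof. by move=> cc' cc'' i lin; rewrite cc'// cc''. Qed.

Lemma agreeW m n c c' : (m <= n)%N -> agree n c c' -> agree m c c'.
Proof. by move=> mn cc' i im; apply: cc'; exact: leq_trans mn. Qed.

Lemma seq_openI D E : seq_open D -> seq_open E -> seq_open (D `&` E).
Proof.
move=> oD oE c [/oD[n Dn] /oE[m Em]]; exists (maxn n m) => c' cc'.
by split; [apply/Dn/(agreeW _ cc')/leq_maxl|apply/Em/(agreeW _ cc')/leq_maxr].
Qed.

Lemma seq_denseI D E :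
  seq_open D -> seq_dense D -> seq_dense E -> seq_dense (D `&` E).
Proof.
move=> oD dD dE c n; have [c' cc' /oD[m Dm]] := dD c n.
have [c'' c'c'' Ec''] := dE c' (maxn n m); exists c''.
  by apply: (agree_trans cc'); exact/(agreeW _ c'c'')/leq_maxl.
by split=> //; exact/Dm/(agreeW _ c'c'')/leq_maxr.
Qed.

End Baire_sequences.

(** * Binary digits of real numbers *)

Section Digits.
Variable R : realType.
Local Open Scope ring_scope.

Definition dyadic (r : R) (n : nat) : int := Num.floor (2 ^+ n * r).
(** [dyadic r n.+1] is [2 * dyadic r n] plus 0 or 1, and the digit is this difference; [dyadic r 0]
    keeps the integer part. *)
Definition digit (r : R) (n : nat) : bool := dyadic r n.+1 != 2 * dyadic r n.

Lemma dyadicP r n :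
  (dyadic r n)%:~R <= 2 ^+ n * r /\ 2 ^+ n * r < (dyadic r n)%:~R + 1.
Proof. by have /andP[? +] := floor_itv (2 ^+ n * r); rewrite intrD. Qed.

Lemma dyadic_def r n (k : int) :
  k%:~R <= 2 ^+ n * r -> 2 ^+ n * r < k%:~R + 1 -> dyadic r n = k.
Proof. by move=> kr rk; apply: floor_def; rewrite kr intrD. Qed.

Lemma dyadicS r n : dyadic r n.+1 = 2 * dyadic r n + (digit r n)%:Z.
Proof.
have [lo hi] := dyadicP r n; have [lo1 hi1] := dyadicP r n.+1.
have dge : 2 * dyadic r n <= dyadic r n.+1.
  rewrite /(dyadic r n.+1) floor_ge_int intrM exprS -mulrA.
  by rewrite ler_pM2l.
have : dyadic r n.+1 < 2 * dyadic r n + 2.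
  rewrite /(dyadic r n.+1) floor_lt_int intrD intrM exprS -mulrA.
  by rewrite -[X in _ < _ + X](mulr1 2) -mulrDr ltr_pM2l.
by rewrite /digit; case: eqP; lia.
Qed.

Lemma dyadic_agree n r q : dyadic r 0 = dyadic q 0 ->
  agree n (digit r) (digit q) -> dyadic r n = dyadic q n.
Proof.
move=> rq0; elim: n => // n IHn rq; rewrite !dyadicS rq// IHn//.
by apply: agreeW rq.
Qed.

Lemma agree_dyadic n r q : dyadic r n = dyadic q n -> agree n (digit r) (digit q).
Proof.
elim: n => // n IHn; rewrite !dyadicS => rq.
have [rqn dd] : dyadic r n = dyadic q n /\ digit r n = digit q n.
  by case: (digit r n) (digit q n) rq => -[]/=; lia.
by move=> i; rewrite ltnS leq_eqVlt => /predU1P[->//|]; exact: IHn.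
Qed.

Lemma dyadic_pred n r q : dyadic r n.+1 = dyadic q n.+1 -> dyadic r n = dyadic q n.
Proof.
by rewrite !dyadicS; case: (digit r n) (digit q n) => -[]/=; lia.
Qed.

(* A tail of ones would put the represented real at the right end bits of
   its half-open dyadic intervals. *)
Lemma digit_realize (k0 : int) (c : nat -> bool) :
  (forall n, exists2 i, (n <= i)%N & ~~ c i) ->
  exists2 r, dyadic r 0 = k0 & digit r =1 c.
Proof.
move=> czero.
pose k := fix k n : int := if n is m.+1 then 2 * k m + (c m)%:Z else k0.
pose a n : R := (k n)%:~R / 2 ^+ n.
pose b n : R := ((k n)%:~R + 1) / 2 ^+ n.
have p2 n : 0 < 2 ^+ n :> R by exact: exprn_gt0.
have kS n : (k n.+1)%:~R = 2 * (k n)%:~R + (c n)%:R :> R.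
  by rewrite /= intrD intrM; case: (c n).
have aS n : a n <= a n.+1.
  rewrite /a ler_pdivlMr// mulrAC ler_pdivrMr// kS exprS.
  have := p2 n; set x := 2 ^+ n; set y := _%:~R => x0.
  by case: (c n) => /=; nra.
have bS n : b n.+1 <= b n.
  rewrite /b ler_pdivlMr// mulrAC ler_pdivrMr// kS exprS.
  have := p2 n; set x := 2 ^+ n; set y := _%:~R => x0.
  by case: (c n) => /=; nra.
have bSlt n : ~~ c n -> b n.+1 < b n.
  move=> /negbTE cn; rewrite /b ltr_pdivlMr// mulrAC ltr_pdivrMr// kS exprS cn.
  have := p2 n; set x := 2 ^+ n; set y := _%:~R => x0.
  by rewrite /=; nra.
have ab n : a n <= b n by rewrite /a /b ler_pM2r ?invr_gt0//; lra.
have amono m n : (m <= n)%N -> a m <= a n.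
  elim: n m => [|n IH] m; first by rewrite leqn0 => /eqP->.
  by rewrite leq_eqVlt => /predU1P[->//|/IH/le_trans]; apply.
have bmono m n : (m <= n)%N -> b n <= b m.
  elim: n m => [|n IH] m; first by rewrite leqn0 => /eqP->.
  by rewrite leq_eqVlt => /predU1P[->//|/IH]; apply: le_trans.
have ab' m n : a m <= b n.
  have := amono _ _ (leq_maxl m n); move=> /le_trans; apply.
  exact: le_trans (ab _) (bmono _ _ (leq_maxr m n)).
pose E := [set a n | n in [set: nat]].
have E0 : E !=set0 by exists (a 0%N), 0%N.
have supE n : a n <= sup E.
  by apply: ub_le_sup; [exists (b 0%N) => _ [m _ <-]|exists n].
have Esup n : sup E <= b n.
  by apply: ge_sup => // _ [m _ <-].
have Esup' n : sup E < b n.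
  have [i ni ci] := czero n.
  by apply: (le_lt_trans (Esup i.+1)); apply: lt_le_trans (bmono _ _ ni); exact: bSlt.
have dk n : dyadic (sup E) n = k n.
  apply: dyadic_def.
    by have := supE n; rewrite /a ler_pdivrMr// mulrC.
  by have := Esup' n; rewrite /b ltr_pdivlMr// mulrC.
exists (sup E); first exact: dk.
move=> n; have := dyadicS (sup E) n; rewrite !dk /=.
by case: (digit _ _) (c n) => -[]//=; lia.
Qed.

Lemma dyadic_close n r q : dyadic r n = dyadic q n -> `|r - q| < 2 ^- n.
Proof.
move=> rq; have [] := dyadicP r n; have [] := dyadicP q n; rewrite rq.
have p2 : 0 < 2 ^+ n :> R by exact: exprn_gt0.
set k := _%:~R => ? ? ? ?.
rewrite -(ltr_pM2l p2) divff ?gt_eqF// -[X in X * `|_|]gtr0_norm// -normrM.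
by rewrite ltr_norml; apply/andP; split; lra.
Qed.

Lemma exp2_small (e : R) : 0 < e -> exists n, 2 ^- n < e.
Proof.
move=> e0; exists (Num.bound e^-1).
have /= eb := archi_boundP (ltW (_ : 0 < e^-1)).
rewrite invf_plt ?posrE// ?exprn_gt0//.
apply: (lt_le_trans (eb _)); first by rewrite invr_gt0.
by rewrite -natrX ler_nat ltnW// ltn_expl.
Qed.

Lemma dyadic_ball (k0 : int) (c : nat -> bool) N : exists r : R,
  [/\ dyadic r 0 = k0, agree N (digit r) c &
      forall s, ball r (2 ^- N.+2) s -> dyadic s N = dyadic r N].
Proof.
(* A single one after the prescribed word puts [r] at the midpoint of its dyadic interval of length
   [2 ^- N], so a ball whose radius is a quarter of that length stays inside. *)
pose c1 i := if (i < N)%N then c i else i == N.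
have [|r r0 rc] := @digit_realize k0 c1.
  move=> j; exists (maxn j N.+1); first exact: leq_maxl.
  rewrite /c1 (_ : (maxn j N.+1 < N)%N = false); last lia.
  by rewrite gtn_eqF// leq_maxr.
exists r; split=> // [i iN|s]; first by rewrite rc /c1 iN.
rewrite -ball_normE /ball_ /= => rs.
have := dyadicP r N.+2; rewrite !dyadicS !rc /c1 ltnn eqxx ltnNge leqnSn/=.
rewrite gtn_eqF// addr0.
have p2 : 0 < 2 ^+ N.+2 :> R by exact: exprn_gt0.
move: rs; rewrite -(ltr_pM2l p2) divff ?gt_eqF// -[X in X * `|_|]gtr0_norm//.
rewrite -normrM ltr_norml => /andP[].
have kE : (2 * (2 * dyadic r N + 1%Z))%:~R = 4 * (dyadic r N)%:~R + 2 :> R.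
  by rewrite intrM [(2 * _ + _)%:~R]intrD intrM; lra.
rewrite kE !exprS => lo hi [].
set k := (dyadic r N)%:~R.
move=> lo' hi'; apply: dyadic_def; rewrite -/k; lra.
Qed.

Lemma dyadic0_eq n r q : dyadic r n = dyadic q n -> dyadic r 0 = dyadic q 0.
Proof. by elim: n => // n IHn /dyadic_pred. Qed.

(** Near any [q], a long initial segment of its digits extends to a word forcing [D]; [dyadic_ball]
    turns this word into a ball, centred close to [q], of reals whose digits all lie in [D]. *)
Lemma nowhere_dense_digit D : seq_open D -> seq_dense D ->
  nowhere_dense [set r : R | ~ D (digit r)].
Proof.
move=> oD dD; rewrite /nowhere_dense -subset0 => q.
rewrite /interior /= -nbhs_ballE => -[e /= e0 sub].
have [n ne] := exp2_small e0.
have [c' qc' /oD[m Dm]] := dD (digit q) n.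
pose N := maxn n m.
have [r [r0 rc rball]] := dyadic_ball (dyadic q 0) c' N.
have rq : dyadic r n = dyadic q n.
  apply: dyadic_agree => //; apply: (@agree_trans _ _ _ c').
    exact: agreeW (leq_maxl _ _) rc.
  exact: agree_sym.
have /sub : ball q e r.
  by rewrite -ball_normE /ball_ /= distrC; exact: lt_trans (dyadic_close rq) ne.
move=> /(_ (ball r (2 ^- N.+2)) (nbhsx_ballx _ _ _)).
case=> [|s [/= nD /rball sr]]; first by rewrite invr_gt0 exprn_gt0.
apply: nD; apply: Dm; apply: (@agreeW _ m N); first exact: leq_maxr.
by apply: (agree_trans (agree_sym rc)); exact/agree_sym/agree_dyadic.
Qed.

(* [dyadic r 0 = 0] restricts to [0 <= r < 1], where the digits determine [r]. *)
Definition avoids (B : set R) : set (nat -> bool) :=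
  [set c | exists n, forall r, dyadic r 0 = 0 -> agree n (digit r) c -> ~ B r].

Lemma seq_open_avoids B : seq_open (avoids B).
Proof.
move=> c [n cB]; exists n => c' cc'; exists n => r r0 rc'.
by apply: cB => //; exact/(agree_trans rc')/agree_sym.
Qed.

(** A word gives a ball of reals sharing these digits. Some [s] in it lies outside the closure of
    [B], and a longer initial segment of the digits of [s] confines reals of integer part 0 to a
    neighbourhood of [s] that misses [B]. *)
Lemma seq_dense_avoids B : nowhere_dense B -> seq_dense (avoids B).
Proof.
move=> ndB c n; have [r [r0 rc rball]] := dyadic_ball 0 c n.
have rcl : ~ interior (closure B) r by rewrite ndB.
have [s rs ncls] : exists2 s, ball r (2 ^- n.+2) s & ~ closure B s.
  apply: contrapT => ns; apply: rcl; rewrite /interior /= -nbhs_ballE.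
  exists (2 ^- n.+2); first by rewrite /= invr_gt0 exprn_gt0.
  by move=> s rs; apply: contrapT => nB; apply: ns; exists s.
have sr := rball _ rs.
have [e /= e0 eB] : exists2 e : R, 0 < e & forall t, ball s e t -> ~ B t.
  apply: contrapT => ne; apply: ncls => V; rewrite -nbhs_ballE => -[e /= e0 eV].
  apply: contrapT => nV; apply: ne; exists e => // t /eV Vt Bt.
  by apply: nV; exists t.
have [m me] := exp2_small e0.
exists (digit s).
  by apply: (agree_trans (agree_sym rc)); exact/agree_sym/agree_dyadic.
exists m => t t0 ts; apply: eB; rewrite -ball_normE /ball_ /= distrC.
apply: lt_trans me; apply/dyadic_close/dyadic_agree => //.
by rewrite t0 (dyadic0_eq sr) r0.
Qed.

End Digits.

(** * Coding sequences over a countable alphabet by bits *)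

Section Unary_columns.
Variables (Q : countType) (q0 : Q).

(* Letter [k] is read off column [k] of the array [c (pickle (k, j))], whose
   initial run of ones encodes it in unary. *)
Definition decode (c : nat -> bool) (k : nat) : Q :=
  if pselect (exists j : nat, ~~ c (pickle (k, j))) is left cfalse then
    odflt q0 (unpickle (ex_minn cfalse))
  else q0.

Lemma decodeP (c : nat -> bool) (k j : nat) :
  (forall i, (i < j)%N -> c (pickle (k, i))) ->
  ~~ c (pickle (k, j)) -> decode c k = odflt q0 (unpickle j).
Proof.
move=> cj ncj; rewrite /decode; case: pselect => [ex|[]]; last by exists j.
case: ex_minnP => m ncm mmin; congr (odflt _ (unpickle _)).
have [mj|jm|//] := ltngtP m j; first by rewrite cj in ncm.
by have := mmin _ ncj; rewrite leqNgt jm.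
Qed.

Lemma decode_ext (c c' : nat -> bool) k :
  (forall j : nat, c (pickle (k, j)) = c' (pickle (k, j))) -> decode c k = decode c' k.
Proof.
move=> cc'; have [[j /= cj]|nc] := pselect (exists j : nat, ~~ c (pickle (k, j))).
  pose ex : exists j : nat, ~~ c (pickle (k, j)) := ex_intro _ j cj.
  have [ncm mmin] : ~~ c (pickle (k, ex_minn ex)) /\
      forall i, (i < ex_minn ex)%N -> c (pickle (k, i)).
    case: ex_minnP => l ncl lmin; split=> // l' l'l.
    by apply/negPn/negP => /lmin; rewrite leqNgt l'l.
  rewrite (decodeP mmin ncm) (@decodeP c' _ (ex_minn ex))//; last by rewrite -cc'.
  by move=> i /mmin; rewrite -cc'.
rewrite /decode; case: pselect => // ?; case: pselect => // -[i ci].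
by case: nc; exists i; rewrite cc'.
Qed.

Lemma pickle_unbounded (k n : nat) : exists j : nat, (n <= pickle (k, j))%N.
Proof.
apply: contrapT => nj.
have lt (j : 'I_n.+1) : (pickle (k, nat_of_ord j) < n)%N.
  by rewrite ltnNge; apply/negP => le; apply: nj; exists j.
have /leq_card : injective (fun j => Ordinal (lt j)).
  by move=> i j /(congr1 val)/(pcan_inj pickleK)[/val_inj].
by rewrite !card_ord ltnn.
Qed.

(** When every column contains a zero, each letter is settled by finitely many bits; for a column of
    ones only, the decoded letter is a mere default. *)
Lemma decode_continuous (c : nat -> bool) :
  (forall k : nat, exists j : nat, ~~ c (pickle (k, j))) ->
  forall m, exists n, forall c', agree n c c' -> agree m (decode c) (decode c').
Proof.
move=> cfalse; elim=> [|m [n nm]]; first by exists 0%N.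
have ex := cfalse m; pose j := ex_minn ex.
exists (maxn n (\max_(i < j.+1) (pickle (m, nat_of_ord i)).+1)) => c' cc' i.
have ccm l : (l <= j)%N -> c (pickle (m, l)) = c' (pickle (m, l)).
  rewrite -ltnS => lj; apply: cc'; rewrite leq_max; apply/orP; right.
  exact: (leq_bigmax (Ordinal lj)).
rewrite ltnS leq_eqVlt => /predU1P[->|]; last first.
  by apply: nm; apply: agreeW cc'; exact: leq_maxl.
have [ncj jmin] : ~~ c (pickle (m, j)) /\ forall l, (l < j)%N -> c (pickle (m, l)).
  rewrite /j; case: ex_minnP => l ncl lmin; split=> // l' l'l.
  by apply/negPn/negP => /lmin; rewrite leqNgt l'l.
rewrite !(@decodeP _ _ j)//; last by rewrite -ccm.
by move=> l lj; rewrite -ccm ?jmin// ltnW.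
Qed.

Lemma seq_dense_decode D : seq_open D -> seq_dense D ->
  seq_dense [set c | exists n, forall c', agree n c c' -> D (decode c')].
Proof.
move=> oD dD c n; pose c1 i := if (i < n)%N then c i else false.
(* The first [n] bits lie in columns below [N]. These columns keep [c1], which is zero from [n] on
   so that they contain a zero; the columns from [N] on are free to spell [g']. *)
pose N := (\max_(i < n) (odflt (0, 0) (@unpickle (nat * nat)%type i)).1.+1)%N.
have [g' cg' Dg'] := dD (decode c1) N.
pose c2 i := if @unpickle (nat * nat)%type i is Some (k, j) then
  if (k < N)%N then c1 i else (j < pickle (g' k))%N else c1 i.
have c2E (k j : nat) : c2 (pickle (k, j)) =
    if (k < N)%N then c1 (pickle (k, j)) else (j < pickle (g' k))%N.
  by rewrite /c2 pickleK.
have c1false (k : nat) : exists j : nat, ~~ c1 (pickle (k, j)).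
  by have [j nj] := pickle_unbounded k n; exists j; rewrite /c1 ltnNge nj.
have c2false (k : nat) : exists j : nat, ~~ c2 (pickle (k, j)).
  have [j nj] := c1false k; have [kN'|kN'] := boolP (k < N)%N.
    by exists j; rewrite c2E kN'.
  by exists (pickle (g' k)); rewrite c2E (negbTE kN') ltnn.
have c2g' k : decode c2 k = g' k.
  have [kN'|kN'] := boolP (k < N)%N.
    by rewrite -cg'//; apply: decode_ext => j; rewrite c2E kN'.
  rewrite (@decodeP _ _ (pickle (g' k))) ?pickleK//.
    by move=> i ik; rewrite c2E (negbTE kN').
  by rewrite c2E (negbTE kN') ltnn.
exists c2.
  move=> i iN; rewrite /c2.
  have c1i : c1 i = c i by rewrite /c1 iN.
  case E: (unpickle i) => [[k j]|] //; rewrite ifT//.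
  apply: leq_trans (leq_bigmax (Ordinal iN)).
  by rewrite /= E.
have /oD[m Dm] : D (decode c2) by rewrite (_ : decode c2 = g')//; exact/funext.
have [n' c2n'] := decode_continuous c2false m.
by exists n' => c' /c2n'; exact: Dm.
Qed.

Lemma seq_open_decode (D : set (nat -> Q)) :
  seq_open [set c | exists n, forall c', agree n c c' -> D (decode c')].
Proof.
move=> c [n Dn]; exists n => c' cc'; exists n => c'' c'c''.
exact/Dn/(agree_trans cc').
Qed.

End Unary_columns.

(** * Covering by meager sets and generic sequences *)

Section Category.
Variable R : realType.
Local Notation K := (cov_meager R).
Hypothesis Kreg : regular_card K.

Lemma nowhere_dense_meager (T : topologicalType) (A : set T) :
  nowhere_dense A -> meager A.
Proof. by move=> ndA; exists (fun=> A) => //; rewrite bigcup_const//; exists 0%N. Qed.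

Lemma meager_bigcup (T : topologicalType) (A : nat -> set T) :
  (forall n, meager (A n)) -> meager (\bigcup_n A n).
Proof.
move=> mA; have /choice[B BP] : forall n, exists B : nat -> set T,
    (forall m, nowhere_dense (B m)) /\ A n = \bigcup_m B m.
  by move=> n; have [B ? ?] := mA n; exists B.
pose p i : nat * nat := odflt (0, 0)%N (unpickle i).
exists (fun i => B (p i).1 (p i).2).
  by move=> i; have [] := BP (p i).1.
rewrite predeqE => x; split=> [[n _]|[i _]].
  have [_ ->] := BP n; move=> [m _ Bx]; exists (pickle (n, m)) => //.
  by rewrite /p pickleK.
by exists (p i).1 => //; have [_ ->] := BP (p i).1; exists (p i).2.
Qed.

(** If [K] were countable, [R] would be a countable union of meager sets, hence meager, and would
    cover itself as a one-element family; then [K] would be finite. *)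
Lemma uncountable_cov : small K [set: nat].
Proof.
have [Kinf _] := Kreg; have [[Kmeager Kcov] Kmin] := cov_meagerP R.
move=> /pcard_surjP[g gK]; apply: Kinf.
suff /Kmin KT : meager_cover [set [set: R]].
  exact: card_le_finite KT (finite_set1 _).
split; last by rewrite bigcup_set1.
move=> _ ->.
pose g' n := if `[< K (g n) >] then g n else set0.
rewrite (_ : [set: R] = \bigcup_n g' n).
  apply: meager_bigcup => n; rewrite /g'; case: asboolP => [/Kmeager//|_].
  exists (fun=> set0); rewrite ?bigcup0// => ?.
  by rewrite /nowhere_dense closure0 interior0.
rewrite -Kcov predeqE => x; split=> [[M KM Mx]|[n _]].
  have [n _ gn] := gK _ KM; exists n => //.
  by rewrite /g' gn; case: asboolP.
by rewrite /g'; case: asboolP => // Kg gx; exists (g n).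
Qed.

(** Otherwise the nowhere dense sets of reals whose digits miss [D i] would form a small cover of
    the line, against the minimality of [cov_meager R]. *)
Lemma generic_bits U (I : set U) (D : U -> set (nat -> bool)) : small K I ->
  (forall i, I i -> seq_open (D i) /\ seq_dense (D i)) ->
  exists c, forall i, I i -> D i c.
Proof.
move=> sI oD; apply: contrapT => nc.
have [_ Kmin] := cov_meagerP R.
apply: (small_image (f := fun i => [set r : R | ~ D i (digit r)]) sI); apply: Kmin.
split=> [_ [i Ii <-]|].
  by have [? ?] := oD _ Ii; exact/nowhere_dense_meager/nowhere_dense_digit.
rewrite predeqE => r; split=> // _; apply: contrapT => nr; apply: nc.
exists (digit r) => i Ii; apply: contrapT => nD; apply: nr.
by exists [set r : R | ~ D i (digit r)] => //; exists i.
Qed.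

Lemma generic_stream (Q : countType) (q0 : Q) U (I : set U) (D : U -> set (nat -> Q)) :
  small K I -> (forall i, I i -> seq_open (D i) /\ seq_dense (D i)) ->
  exists c, forall i, I i -> D i c.
Proof.
move=> sI oD; pose D' i :=
  [set c | exists n, forall c', agree n c c' -> D i (decode q0 c')].
have [|c cD] := @generic_bits _ I D' sI.
  by move=> i /oD[oDi dDi]; split; [exact: seq_open_decode|exact: seq_dense_decode].
by exists (decode q0 c) => i /cD[n]; apply.
Qed.

Lemma cofinal_dense (A : choiceType) : cov_meager R #= cof_meager R ->
  [set: A] #= K -> exists T : A -> nat -> set (nat -> bool),
    (forall a m, seq_open (T a m) /\ seq_dense (T a m)) /\
    forall D, seq_open D -> seq_dense D ->
      exists a, forall c, (forall m, T a m c) -> D c.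
Proof.
move=> cov_cof AK; have [[Cmeager Ccof] _] := cof_meagerP R.
have : cof_meager R #<= [set: A].
  by rewrite (card_le_eqr AK) -(card_le_eql cov_cof).
move=> /pcard_surjP[g gsurj].
have /choice[B BP] : forall a, exists B : nat -> set R,
    (forall m, nowhere_dense (B m)) /\ (cof_meager R (g a) -> g a = \bigcup_m B m).
  move=> a; have [/Cmeager[B ? ?]|ncof] := pselect (cof_meager R (g a)).
    by exists B.
  by exists (fun=> set0); split=> // _; rewrite /nowhere_dense closure0 interior0.
(* These sets exclude tails of ones, so that a point of all [T a m] is the digit sequence of a real
   of integer part 0, to which the cofinal family applies. *)
pose late m : set (nat -> bool) := [set c | exists2 i, (m <= i)%N & ~~ c i].
have olate m : seq_open (late m).
  move=> c [i mi ci]; exists i.+1 => c' cc'; exists i => //.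
  by rewrite -cc'.
have dlate m : seq_dense (late m).
  move=> c n; exists (fun i => if (i < n)%N then c i else false).
    by move=> i iltn; rewrite iltn.
  by exists (maxn m n); rewrite ?leq_maxl// ltnNge leq_maxr.
exists (fun a m => avoids (B a m) `&` late m); split=> [a m|D oD dD].
  have oa := @seq_open_avoids R (B a m).
  split; first exact: seq_openI.
  by apply: seq_denseI => //; apply: seq_dense_avoids; have [] := BP a.
have [N cofN DN] := Ccof _ (nowhere_dense_meager (@nowhere_dense_digit R _ oD dD)).
have [a _ gN] := gsurj _ cofN; exists a => c Tc.
have [|r r0 rc] := @digit_realize R 0 c; first by move=> n; have [] := Tc n.
rewrite -(_ : digit r = c); last exact/funext.
apply: contrapT => /DN; rewrite -gN (BP a).2 ?gN// => -[m _ Br].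
by have [[n cB] _] := Tc m; apply: (cB r).
Qed.

End Category.

(** * A dominating family *)

(** Compactness of the Cantor cube: only finitely many words of length [i] have to be extended, and
    [L] is the maximum of the lengths that serve them. *)
Lemma uniform_extension (E : set (nat -> bool)) i : seq_open E -> seq_dense E ->
  exists L, forall c, exists2 c', agree i c c' & forall c'', agree L c' c'' -> E c''.
Proof.
move=> oE dE.
(* One length [L] serves all continuations of the first [n] bits of [c0]. Descending from [n = i] to
   [n = 0], each step takes the larger of the lengths for the two values of the next bit. *)
pose P n c0 := exists L, forall c, agree n c0 c -> exists2 c',
  agree i c c' & forall c'', agree L c' c'' -> E c''.
suff PP k : (k <= i)%N -> forall c0, P (i - k)%N c0.
  have [L LP] := PP i (leqnn i) (fun=> false); exists L => c; apply: LP => j.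
  by rewrite subnn.
elim: k => [_ c0|k IHk ki c0].
  have [c' c0c' /oE[L LE]] := dE c0 i; exists L => c; rewrite subn0 => c0c.
  by exists c' => //; apply: agree_trans c0c'; exact: agree_sym.
have {}IHk := IHk (ltnW ki); set n := (i - k.+1)%N.
have nS : (i - k)%N = n.+1 by rewrite /n; lia.
pose upd b j := if j == n then b else c0 j.
have [L0 L0P] := IHk (upd false); have [L1 L1P] := IHk (upd true).
exists (maxn L0 L1) => c c0c; rewrite nS in L0P L1P.
have updc : agree n.+1 (upd (c n)) c.
  move=> j; rewrite ltnS leq_eqVlt /upd => /predU1P[->|jn]; first by rewrite eqxx.
  by rewrite ltn_eqF// c0c.
case: (c n) updc => [/L1P|/L0P] [c' cc' c'E]; exists c' => // c'' c'c''.
  by apply: c'E; apply: agreeW c'c''; exact: leq_maxr.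
by apply: c'E; apply: agreeW c'c''; exact: leq_maxl.
Qed.

(** [d a i] is so large that every word of length [i] extends, before position [d a i], to a word
    forcing the first [i + 1] sets of [T a]. A monotone function escaping all [d a] would yield a
    dense open set containing no [\bigcap_m T a m]. *)
Lemma dominating_of_cofinal (A : Type) (T : A -> nat -> set (nat -> bool)) :
  (forall a m, seq_open (T a m) /\ seq_dense (T a m)) ->
  (forall D, seq_open D -> seq_dense D ->
    exists a, forall c, (forall m, T a m c) -> D c) ->
  exists d : A -> nat -> nat, forall f : nat -> nat, {homo f : m n / (m <= n)%N} ->
    exists a N, forall n, (N <= n)%N -> (f n <= d a n)%N.
Proof.
move=> oT cT.
pose TI a i := [set c | forall j, (j <= i)%N -> T a j c].
have oTI a i : seq_open (TI a i) /\ seq_dense (TI a i).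
  elim: i => [|i [oi di]].
    have [o0 d0] := oT a 0%N.
    have TI0 : TI a 0%N = T a 0%N.
      rewrite predeqE => c; split=> [/(_ 0%N (leqnn _))//|Tc j].
      by rewrite leqn0 => /eqP->.
    by rewrite TI0.
  have [oS dS] := oT a i.+1.
  have -> : TI a i.+1 = TI a i `&` T a i.+1.
    rewrite predeqE => c; split=> [Tc|[Tic TSc] j].
      by split=> [j ji|]; apply: Tc => //; exact: leqW.
    by rewrite leq_eqVlt => /predU1P[->//|]; exact: Tic.
  by split; [exact: seq_openI|exact: seq_denseI].
have /choice[d dP] : forall ai : A * nat, exists L, (ai.2 <= L)%N /\ forall c,
    exists2 c', agree ai.2 c c' & forall c'', agree L c' c'' -> TI ai.1 ai.2 c''.
  move=> [a i] /=; have [oi di] := oTI a i.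
  have [L LP] := uniform_extension i oi di; exists (maxn i L).
  split=> [|c]; first exact: leq_maxl.
  have [c' cc' c'T] := LP c; exists c' => // c'' c'c''; apply: c'T.
  by apply: agreeW c'c''; exact: leq_maxr.
exists (fun a i => d (a, i)) => f fmono; apply: contrapT => nd.
(* If [d a i < f i] infinitely often, some point in every [T a m] has no zero
   block [i, f i]: it is built from pieces placed in [i, d a i] for such [i],
   all its other bits being ones. *)
pose D := [set c : nat -> bool |
  exists i, forall j, (i <= j <= maxn i (f i))%N -> c j = false].
have [||a aD] := cT D.
- move=> c [i ci]; exists (maxn i (f i)).+1 => c' cc'; exists i => j /andP[ij jf].
  by rewrite -cc'// ci// ij.
- move=> c n; exists (fun j => if (j < n)%N then c j else false).
    by move=> j jn; rewrite jn.
  by exists n => j /andP[nj _]; rewrite ltnNge nj.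
have inf N : exists2 i, (N <= i)%N & (d (a, i) < f i)%N.
  apply: contrapT => ni; apply: nd; exists a, N => n Nn.
  by rewrite leqNgt; apply/negP => dn; apply: ni; exists n.
pose R (s s' : (nat -> bool) * nat) := exists i,
  [/\ (s.2 <= i)%N, (i <= d (a, i) < f i)%N, s'.2 = (d (a, i)).+1,
    agree s.2 s.1 s'.1 & [/\ (forall j, (s.2 <= j < i)%N -> s'.1 j),
      s'.1 (d (a, i)) & forall c, agree s'.2 s'.1 c -> TI a i c]].
have /choice[step stepP] : forall s, exists s', R s s'.
  move=> [c n]; have [i ni dif] := inf n.
  have [idi /(_ (fun j => if (j < n)%N then c j else true))[c' cc' c'T]] := dP (a, i).
  pose c2 j := if (j < d (a, i))%N then c' j else true.
  exists (c2, (d (a, i)).+1), i; split=> //=.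
  - by rewrite idi dif.
  - move=> j jn; rewrite /c2 (leq_trans jn) ?(leq_trans ni)//.
    by rewrite -cc' ?jn//; exact: leq_trans ni.
  split=> [j /andP[nj ji]||c3 c2c3].
  - by rewrite /c2 (leq_trans ji)// -cc'// ltnNge nj.
  - by rewrite /c2 ltnn.
  - by apply: c'T => j jd; rewrite -c2c3 ?ltnS ?(ltnW jd)// /c2 jd.
pose st k := iter k step (fun=> false, 0%N).
have stR k : R (st k) (st k.+1) by rewrite /= ; exact: stepP.
have stlt k : ((st k).2 < (st k.+1).2)%N.
  by have [i [ki /andP[id _] -> _ _]] := stR k; lia.
have stle k l : (k <= l)%N -> ((st k).2 <= (st l).2)%N.
  elim: l => [|l IH]; first by rewrite leqn0 => /eqP->.
  rewrite leq_eqVlt => /predU1P[->//|/IH kl]; exact/(leq_trans kl)/ltnW/stlt.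
have kst k : (k <= (st k).2)%N.
  by elim: k => // k IH; exact: leq_ltn_trans IH (stlt k).
have stagree k l : (k <= l)%N -> agree (st k).2 (st k).1 (st l).1.
  elim: l => [|l IH]; first by rewrite leqn0 => /eqP->.
  rewrite leq_eqVlt => /predU1P[->//|kl]; apply: (agree_trans (IH kl)).
  have [i [_ _ _ + _]] := stR l; apply: agreeW; exact: stle.
pose c j := (st j.+1).1 j.
have stc k : agree (st k).2 (st k).1 c.
  move=> j jk; rewrite /c; have [kj|jk'] := leqP k j.+1; first exact: stagree.
  by apply/esym; apply: stagree (ltnW jk') _ _; exact: kst.
have [i' ci'] : D c.
  apply: aD => m; have [i [mi _ _ _ [_ _ Ti]]] := stR m.
  by apply: (Ti c (stc m.+1)); apply: leq_trans mi; exact: kst.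
(* [k] is the stage whose new bits contain position [i']. If [i'] precedes the chosen [i], it
   carries a filler one; otherwise [d (a, i) < f i <= f i'] puts the final one of the stage inside
   the zero block. *)
have ex : exists k, (i' < (st k.+1).2)%N by exists i'; exact: kst.
case: (ex_minnP ex) => k i'k kmin.
have ki' : ((st k).2 <= i')%N.
  by case: k kmin {i'k} => // k kmin; rewrite leqNgt; apply/negP => /kmin; rewrite ltnn.
have [i [si /andP[id df] Es _ [cj cd _]]] := stR k.
have := stc k.+1; rewrite Es => stc'.
have [i'i|ii'] := ltnP i' i.
  have := ci' i'; rewrite -stc'; last by rewrite -Es.
  by rewrite cj ?ki'// leqnn leq_maxl => /(_ isT).
have := ci' (d (a, i)); rewrite -stc' ?cd; last by rewrite ltnSn.
move: i'k; rewrite Es ltnS => -> /=; rewrite leq_max.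
by rewrite (leq_trans (ltnW df) (fmono _ _ ii')) orbT => /(_ isT).
Qed.

(** * Generic pairs above a function *)

Section Pair.
Variable d : nat -> nat.

Definition max_upto n := \max_(i < n.+1) d i.

Lemma leq_max_upto m n : (m <= n)%N -> (d m <= max_upto n)%N.
Proof. by rewrite -ltnS => mn; exact: (leq_bigmax (Ordinal mn)). Qed.

Definition pad e (s : seq bool) := s ++ nseq (e - size s) false.

Lemma size_pad e s : size (pad e s) = maxn (size s) e.
Proof. by rewrite size_cat size_nseq maxnE. Qed.

(* After the padding, the ones added to one string lie above [d n] for every
   [n] such that the other string already has an [n]-th one. *)
Definition extend (st : bool -> seq bool) (l : bool * seq bool) (b : bool) :=
  if b == l.1 then pad (max_upto (count id (st (~~ b)))) (st b) ++ l.2 else st b.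

(** A sequence of moves over the countable alphabet [bool * seq bool] builds two strings at once, so
    that [generic_stream] can produce a pair of points subject to a joint constraint. *)
Definition play (g : nat -> bool * seq bool) :=
  fix play k := if k is n.+1 then extend (play n) (g n) else fun=> [::].

Lemma play_agree k g g' : agree k g g' -> play g k = play g' k.
Proof.
elim: k => //= k IHk gg'; rewrite IHk ?gg'//.
by apply: agreeW gg'.
Qed.

Lemma playS g k b : exists s, play g k.+1 b = play g k b ++ s.
Proof.
rewrite /= /extend; case: ifP => _; last by exists [::]; rewrite cats0.
by rewrite -catA; eexists.
Qed.

Lemma play_prefix g k l b : (k <= l)%N -> exists s, play g l b = play g k b ++ s.
Proof.
elim: l => [|l IHl]; first by rewrite leqn0 => /eqP->; exists [::].
rewrite leq_eqVlt => /predU1P[->|/IHl[s sP]]; first by exists [::]; rewrite cats0.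
by have [s' ->] := playS g l b; rewrite sP -catA; eexists.
Qed.

Definition outcome g b (j : nat) : bool := `[< exists k, nth false (play g k b) j >].

Lemma outcomeE g k b j : (j < size (play g k b))%N ->
  outcome g b j = nth false (play g k b) j.
Proof.
move=> jk; apply/asboolP/idP => [[l]|]; last by exists k.
have [lk|/ltnW kl] := leqP l k.
  have [s ->] := play_prefix g b lk; rewrite nth_cat.
  by case: ltnP => // jl; rewrite nth_default.
by have [s ->] := play_prefix g b kl; rewrite nth_cat jk.
Qed.

(** The bound [d n <= max(s(n), t(n))] for finite strings: [p] and [q] are the positions of the
    [n]-th ones, identified by the number [n] of ones before them. *)
Definition separated (s t : seq bool) := forall p q, nth false s p -> nth false t q ->
  count id (take p s) = count id (take q t) ->
  (d (count id (take q t)) <= maxn p q)%N.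

Lemma separatedC s t : separated s t -> separated t s.
Proof. by move=> st p q tp sq tpsq; rewrite -tpsq maxnC st. Qed.

(** Old ones keep their positions and ranks. A new one lies at or beyond the padding length, which
    bounds [d] at every rank occurring in [t]. *)
Lemma separated_move s t u : separated s t ->
  separated (pad (max_upto (count id t)) s ++ u) t.
Proof.
move=> st p q; set s' := _ ++ u => sp tq.
have [ps|sp'] := ltnP p (size s).
  have ts : take p s' = take p s.
    by rewrite /s' /pad -catA take_cat ps.
  rewrite ts; apply: st => //.
  by move: sp; rewrite /s' /pad -catA nth_cat ps.
move=> _; apply: (@leq_trans (max_upto (count id t))).
  by apply: leq_max_upto; rewrite -{2}(cat_take_drop q t) count_cat leq_addr.
rewrite leq_max; apply/orP; left; rewrite leqNgt; apply/negP => pm.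
move: sp; rewrite /s' nth_cat size_pad leq_max pm orbT.
by rewrite /pad nth_cat ltnNge sp'/= nth_nseq if_same.
Qed.

Lemma play_separated g k b : separated (play g k b) (play g k (~~ b)).
Proof.
elim: k b => [b p q|k IHk b]; first by rewrite nth_nil.
have mv := @separated_move.
rewrite /= /extend; case: b; case: (g k) => [[] u] /=.
- exact: (mv _ _ u (IHk true)).
- exact: separatedC (mv _ _ u (IHk false)).
- exact: separatedC (mv _ _ u (IHk true)).
- exact: (mv _ _ u (IHk false)).
Qed.

Lemma count_outcome g k b p : (p < size (play g k b))%N ->
  count (outcome g b) (iota 0 p) = count id (take p (play g k b)).
Proof.
move=> pk; rewrite -[LHS](count_map (outcome g b) id); congr count.
apply: (@eq_from_nth _ false); first by rewrite size_map size_iota size_take pk.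
move=> i; rewrite size_map size_iota => ip.
rewrite (nth_map 0%N) ?size_iota// nth_iota// add0n nth_take//.
by apply: outcomeE; exact: ltn_trans pk.
Qed.

Lemma outcome_separated g p q : outcome g false p -> outcome g true q ->
  count (outcome g false) (iota 0 p) = count (outcome g true) (iota 0 q) ->
  (d (count (outcome g true) (iota 0 q)) <= maxn p q)%N.
Proof.
move=> /asboolP[k pk] /asboolP[l ql].
have lt b m r : nth false (play g m b) r -> (r < size (play g m b))%N.
  by move=> rm; rewrite ltnNge; apply/negP => /(nth_default false) rF; rewrite rF in rm.
have upto b m n r : (m <= n)%N -> nth false (play g m b) r -> nth false (play g n b) r.
  move=> mn rm; have [s ->] := play_prefix g b mn.
  by rewrite nth_cat lt.
have {}pk := upto _ _ _ _ (leq_maxl k l) pk.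
have {}ql := upto _ _ _ _ (leq_maxr k l) ql.
rewrite (count_outcome (lt _ _ _ pk)) (count_outcome (lt _ _ _ ql)).
exact: (@play_separated g _ false).
Qed.

Definition outcome_meets b (D : set (nat -> bool)) : set (nat -> bool * seq bool) :=
  [set g | exists k, forall c,
    (forall j, (j < size (play g k b))%N -> c j = nth false (play g k b) j) -> D c].

Lemma outcome_meetsP b D g : outcome_meets b D g -> D (outcome g b).
Proof. by move=> [k]; apply=> j; exact: outcomeE. Qed.

Lemma seq_open_outcome_meets b D : seq_open (outcome_meets b D).
Proof.
move=> g [k gD]; exists k => g' gg'; exists k.
by rewrite -(play_agree gg').
Qed.

Lemma seq_dense_outcome_meets b D :
  seq_open D -> seq_dense D -> seq_dense (outcome_meets b D).
Proof.
move=> oD dD g n; pose s := pad (max_upto (count id (play g n (~~ b)))) (play g n b).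
have [c sc /oD[m Dm]] := dD (nth false s) (size s).
pose g' i := if (i < n)%N then g i else (b, mkseq (fun j => c (size s + j)%N) m).
have gg' : agree n g g' by move=> i iltn; rewrite /g' iltn.
exists g' => //; exists n.+1 => c'.
rewrite /= -(play_agree gg') /extend /g' ltnn eqxx /= -/s size_cat size_mkseq => c'P.
apply: Dm => j jm; have jlt : (j < size s + m)%N by rewrite ltn_addl.
rewrite c'P// nth_cat; case: ltnP => [js|sj]; first by rewrite sc.
by rewrite nth_mkseq ?subnKC// ltn_subLR.
Qed.

End Pair.

Lemma generic_pair (R : realType) (d : nat -> nat) U (I : set U)
    (D : U -> set (nat -> bool)) : regular_card (cov_meager R) ->
  small (cov_meager R) I -> (forall i, I i -> seq_open (D i) /\ seq_dense (D i)) ->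
  exists x y : nat -> bool, [/\ (forall i, I i -> D i x /\ D i y),
    (forall m, exists2 i, (m <= i)%N & x i), (forall m, exists2 i, (m <= i)%N & y i) &
    forall p q, x p -> y q -> count x (iota 0 p) = count y (iota 0 q) ->
      (d (count y (iota 0 q)) <= maxn p q)%N].
Proof.
move=> Kreg sI oD; have Ku := uncountable_cov Kreg.
pose late m : set (nat -> bool) := [set c | exists2 i, (m <= i)%N & c i].
have olate m : seq_open (late m).
  move=> c [i mi ci]; exists i.+1 => c' cc'; exists i => //.
  by rewrite -cc'.
have dlate m : seq_dense (late m).
  move=> c n; exists (fun i => if (i < n)%N then c i else true).
    by move=> i iltn; rewrite iltn.
  by exists (maxn m n); rewrite ?leq_maxl// ltnNge leq_maxr.
pose E (s : U + nat) := match s with inl i => D i | inr m => late m end.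
pose J := (inl @` I) `|` (inr @` [set: nat]) : set (U + nat).
have oE s : J s -> seq_open (E s) /\ seq_dense (E s).
  case=> [[i Ii <-]|[m _ <-]]; first exact: oD.
  by split; [exact: olate|exact: dlate].
have sJ : small (cov_meager R) J.
  by apply: (smallU Kreg Ku); apply: small_image => //; exact: (small_countType Ku).
have [||g gE] := @generic_stream R _ (false, [::] : seq bool) _ (J `*` [set: bool])
    (fun sb => outcome_meets d sb.2 (E sb.1)).
- by apply: (smallX Kreg) => //; exact: (small_countType Ku).
- move=> [s b] [/= /oE[oEs dEs] _]; split; first exact: seq_open_outcome_meets.
  exact: seq_dense_outcome_meets.
have gEb b s : J s -> E s (outcome d g b).
  by move=> Js; apply: outcome_meetsP; exact: (gE (s, b)).
have late_g b m : late m (outcome d g b) by apply: (gEb b (inr m)); right; exists m.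
exists (outcome d g false), (outcome d g true); split => //.
- by move=> i Ii; split; [apply: (gEb false (inl i))|apply: (gEb true (inl i))];
    left; exists i.
- by move=> m; exact: late_g.
- by move=> m; exact: late_g.
- exact: outcome_separated.
Qed.

(** * Generic sequences of points *)

Local Notation bits := (nat -> bool).
Local Notation zero := (fun=> false : bool).

Definition join (c w : bits) : bits := fun n => if odd n then w n./2 else c n./2.
Definition evens (w : bits) : bits := fun n => w n.*2.
Definition odds (w : bits) : bits := fun n => w n.*2.+1.

Lemma evens_join c w : evens (join c w) = c.
Proof. by apply/funext => n; rewrite /evens /join odd_double doubleK. Qed.

Lemma odds_join c w : odds (join c w) = w.
Proof. by apply/funext => n; rewrite /odds /join/= odd_double /= uphalf_double. Qed.

Lemma join_evens_odds w : join (evens w) (odds w) = w.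
Proof.
apply/funext => n; rewrite /join /evens /odds -[in RHS](odd_double_half n).
by case: (odd n).
Qed.

Lemma agree_join n c c' w w' : agree n c c' -> agree n w w' ->
  agree n (join c w) (join c' w').
Proof.
move=> cc' ww' i iltn; rewrite /join.
by case: (odd i); [apply: ww'|apply: cc']; lia.
Qed.

Lemma agree_evens n w w' : agree n.*2 w w' -> agree n (evens w) (evens w').
Proof. by move=> ww' i iltn; apply: ww'; lia. Qed.

Lemma agree_odds n w w' : agree n.*2 w w' -> agree n (odds w) (odds w').
Proof. by move=> ww' i iltn; apply: ww'; lia. Qed.

(* Coordinates are interleaved, so that slicing a subset of the Cantor cube at
   a point gives again a subset of the Cantor cube, and can be iterated. *)
Definition slice (T : set bits) (c : bits) : set bits := [set w | T (join c w)].

Lemma seq_open_slice T c : seq_open T -> seq_open (slice T c).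
Proof.
by move=> oT w /oT[n Tn]; exists n => w' ww'; apply: Tn; exact: agree_join.
Qed.

(** For dense open [T], density of the section at [c] is split into countably many dense open
    conditions on [c], one for each word [t], as in the Kuratowski-Ulam theorem. *)
Definition slice_meets (T : set bits) (t : seq bool) : set bits :=
  [set c | exists2 w, agree (size t) (nth false t) w & T (join c w)].

Lemma seq_open_slice_meets T t : seq_open T -> seq_open (slice_meets T t).
Proof.
move=> oT c [w tw /oT[n Tn]]; exists n => c' cc'; exists w => //.
by apply: Tn; exact: agree_join.
Qed.

Lemma seq_dense_slice_meets T t : seq_dense T -> seq_dense (slice_meets T t).
Proof.
move=> dT c n; have [v cv Tv] := dT (join c (nth false t)) (maxn n (size t)).*2.
exists (evens v).
  by have := agree_evens cv; rewrite evens_join; apply: agreeW; exact: leq_maxl.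
exists (odds v); last by rewrite join_evens_odds.
by have := agree_odds cv; rewrite odds_join; apply: agreeW; exact: leq_maxr.
Qed.

Lemma seq_dense_slice T c : (forall t, slice_meets T t c) -> seq_dense (slice T c).
Proof.
move=> Tc w n; have [w' ww' Tw'] := Tc (mkseq w n); exists w' => //.
by move=> i iltn; rewrite -ww' ?size_mkseq// nth_mkseq.
Qed.

Lemma seq_open_slices T zs : seq_open T -> seq_open (foldl slice T zs).
Proof. by elim: zs T => //= c zs IHzs T oT; apply: IHzs; exact: seq_open_slice. Qed.

Definition joins (zs : seq bits) (w : bits) := foldr join w zs.

Fixpoint unjoin n (w : bits) : seq bits :=
  if n is m.+1 then evens w :: unjoin m (odds w) else [::].

Definition rest n (w : bits) : bits := iter n odds w.

Lemma slices_joins T zs w : foldl slice T zs w <-> T (joins zs w).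
Proof. by elim: zs T => //= c zs IHzs T; rewrite IHzs. Qed.

Lemma unjoin_joins zs w : unjoin (size zs) (joins zs w) = zs.
Proof. by elim: zs => //= c zs IHzs; rewrite evens_join odds_join IHzs. Qed.

Lemma size_unjoin n w : size (unjoin n w) = n.
Proof. by elim: n w => //= n IHn w; rewrite IHn. Qed.

Lemma joins_unjoin n w : joins (unjoin n w) (rest n w) = w.
Proof.
elim: n w => //= n IHn w; rewrite /rest -iterS iterSr IHn.
exact: join_evens_odds.
Qed.

Definition tuple_agree n (zs zs' : seq bits) :=
  size zs = size zs' /\ forall i, agree n (nth zero zs i) (nth zero zs' i).

Lemma tuple_agree_refl n zs : tuple_agree n zs zs. Proof. by []. Qed.

Lemma tuple_agree_trans n zs zs' zs'' :
  tuple_agree n zs zs' -> tuple_agree n zs' zs'' -> tuple_agree n zs zs''.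
Proof.
by move=> [s a] [s' a']; split=> [|i]; [rewrite s|exact: agree_trans (a i) (a' i)].
Qed.

Lemma tuple_agree_cons n c c' zs zs' : agree n c c' -> tuple_agree n zs zs' ->
  tuple_agree n (c :: zs) (c' :: zs').
Proof. by move=> cc' [s a]; split=> [|[|i]]; [rewrite /= s|exact: cc'|exact: a]. Qed.

Lemma agree_unjoin n k w : exists m, forall w', agree m w w' ->
  tuple_agree k (unjoin n w) (unjoin n w').
Proof.
elim: n w => [|n IHn] w; first by exists 0%N.
have [m mP] := IHn (odds w); exists (maxn k m).*2 => w' ww' /=.
apply: tuple_agree_cons.
  by apply: agree_evens; apply: agreeW ww'; rewrite leq_double leq_maxl.
apply: mP; apply: agree_odds; apply: agreeW ww'.
by rewrite leq_double leq_maxr.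
Qed.

Lemma agree_joins n zs zs' w :
  tuple_agree n zs zs' -> agree n (joins zs w) (joins zs' w).
Proof.
elim: zs zs' => [|c zs IHzs] [|c' zs'] [] //= [sz] a.
apply: agree_join; first exact: (a 0%N).
by apply: IHzs; split=> // i; exact: (a i.+1).
Qed.

Definition tuple_open (D : set (seq bits)) :=
  forall zs, D zs -> exists n, forall zs', tuple_agree n zs zs' -> D zs'.

Definition tuple_dense (s : nat) (D : set (seq bits)) :=
  forall zs n, size zs = s -> exists2 zs', tuple_agree n zs zs' & D zs'.

Lemma seq_open_unjoin n D : tuple_open D -> seq_open [set w | D (unjoin n w)].
Proof.
move=> oD w /oD[k Dk]; have [m mP] := agree_unjoin n k w.
by exists m => w' /mP; exact: Dk.
Qed.

Lemma seq_dense_unjoin n D : tuple_dense n D -> seq_dense [set w | D (unjoin n w)].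
Proof.
move=> dD w k; have [zs ws Dzs] := dD (unjoin n w) k (size_unjoin n w).
exists (joins zs (rest n w)).
  by have := agree_joins (rest n w) ws; rewrite joins_unjoin.
have -> : n = size zs by rewrite -ws.1 size_unjoin.
by rewrite /= unjoin_joins.
Qed.

(** * Recursive construction of generic points and simultaneous selection *)

(** Choice along a well-founded relation, for requirements on the value at [a] that depend only on
    the values at points below [a]; [p0] fills in the others. *)
Lemma wf_choice (A : Type) (lt : rel A) (P : Type) (p0 : P)
    (good : (A -> P) -> A -> P -> Prop) :
  well_founded lt -> (forall h a, exists p, good h a p) ->
  (forall h h' a p, (forall b, lt b a -> h b = h' b) -> good h a p -> good h' a p) ->
  exists f, forall a, good f a (f a).
Proof.
move=> ltwf goodex good_ext.
have /choice[G GP] : forall ha : (A -> P) * A, exists p, good ha.1 ha.2 p.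
  by move=> [h a]; exact: goodex.
pose F a (rec : forall b, lt b a -> P) : P :=
  G (fun b => if pselect (lt b a) is left ba then rec b ba else p0, a).
pose f := Fix ltwf (fun=> P) F.
exists f => a; rewrite {2}/f Fix_eq; last first.
  move=> b r r' rr'; rewrite /F; congr (G (_, _)); apply/funext => c.
  by case: pselect.
apply: (good_ext _ _ _ _ _ (GP (_, a))) => b ba /=.
by case: pselect.
Qed.

Section Generic.
Variables (R : realType) (A : choiceType) (lt : rel A).
Local Notation K := (cov_meager R).
Hypothesis Kreg : regular_card K.
Hypothesis ltwf : well_founded lt.
Hypothesis lttr : transitive lt.
Hypothesis lttri : forall a b, [\/ lt a b, a = b | lt b a].
Hypothesis ltsmall : forall a, small K [set b | lt b a].
Variables (T : A -> nat -> set bits) (d : A -> nat -> nat).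
Hypothesis oT : forall a m, seq_open (T a m) /\ seq_dense (T a m).
Hypothesis Tcofinal :
  forall D, seq_open D -> seq_dense D -> exists a, forall c, (forall m, T a m c) -> D c.

(** The list increases from above [b], so each section is taken at a point chosen after stage [b]
    and after all the points already used. *)
Definition generic (z : A -> bits) := forall b m l, path lt b l ->
  seq_dense (foldl slice (T b m) (map z l)).

Definition side (p : bits * bits) (i : bool) := if i then p.2 else p.1.

Lemma generic_pairs : exists x y : A -> bits, [/\ generic x, generic y &
  forall a, [/\ (forall m, exists2 i, (m <= i)%N & x a i),
    (forall m, exists2 i, (m <= i)%N & y a i) &
    forall p q, x a p -> y a q -> count (x a) (iota 0 p) = count (y a) (iota 0 q) ->
      (d a (count (y a) (iota 0 q)) <= maxn p q)%N]].
Proof.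
pose V (h : A -> bits * bits) b m l i := foldl slice (T b m) [seq side (h c) i | c <- l].
pose good (h : A -> bits * bits) a p :=
  (forall b m l i, lt b a -> (forall c, c \in l -> lt c a) ->
    seq_dense (V h b m l i) ->
    seq_dense (slice (V h b m l i) p.1) /\
    seq_dense (slice (V h b m l i) p.2)) /\
  [/\ (forall m, exists2 i, (m <= i)%N & p.1 i),
    (forall m, exists2 i, (m <= i)%N & p.2 i) &
    forall r q, p.1 r -> p.2 q -> count p.1 (iota 0 r) = count p.2 (iota 0 q) ->
      (d a (count p.2 (iota 0 q)) <= maxn r q)%N].
have [||f fgood] := @wf_choice A lt _ (zero, zero) good ltwf.
- move=> h a.
  (* One requirement for each earlier code, side, word and finite list of earlier points; a section
     that is not dense imposes nothing. Initial segments being small, so is the set of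
     requirements. *)
  pose D (u : A * nat * seq A * bool * seq bool) :=
    let: (b, m, l, i, t) := u in
    if `[< seq_dense (V h b m l i) >] then slice_meets (V h b m l i) t else setT.
  pose I := [set u : A * nat * seq A * bool * seq bool |
    lt u.1.1.1.1 a /\ forall c, c \in u.1.1.2 -> lt c a].
  have [||x [y [xyD xinf yinf xy]]] := @generic_pair R (d a) _ I D Kreg.
  + pose S := [set b | lt b a].
    have Ku := uncountable_cov Kreg.
    have : small K (S `*` [set: nat] `*` [set l : seq A | forall c, c \in l -> S c]
        `*` [set: bool] `*` [set: seq bool]).
      do !apply: (smallX Kreg); try exact: (small_countType Ku).
        exact: ltsmall.
      by apply: (small_seq Kreg Ku); exact: ltsmall.
    by apply: small_sub => -[[[[b m] l] i] t] [/= ba la]; do !split.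
  + move=> [[[[b m] l] i] t] _ /=; case: asboolP => [dV|_]; last first.
      by split=> [c _|c n]; [exists 0%N|exists c].
    split; last exact: seq_dense_slice_meets.
    by apply: seq_open_slice_meets; apply: seq_open_slices; have [] := oT b m.
  exists (x, y); split=> // b m l i ba la dV.
  by split; apply: seq_dense_slice => t; have := xyD (b, m, l, i, t) (conj ba la);
    rewrite /D; case: asboolP => // _ [].
- move=> h h' a p hh' [gp1 gp2]; split=> // b m l i ba la.
  have -> : V h' b m l i = V h b m l i.
    by congr foldl; apply/eq_in_map => c /la /hh' ->.
  exact: gp1.
have fgen i : generic (fun a => side (f a) i).
  (* The last entry [a] lies above [b] and above all of [l], so its choice took the section along
     [l] into account. *)
  move=> b m l; elim/last_ind: l => [_|l a IHl]; first by have [] := oT b m.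
  rewrite rcons_path => /andP[bl la]; rewrite map_rcons foldl_rcons.
  have [/(_ b m l i) + _] := fgood a.
  have : sorted lt (rcons (b :: l) a) by rewrite /= rcons_path bl.
  rewrite (sorted_pairwise lttr) pairwise_rcons => /andP[/=/andP[ba /allP lta] _].
  by move=> /(_ ba lta (IHl bl)) []; case: (i).
exists (fun a => (f a).1), (fun a => (f a).2); split.
- exact: (fgen false).
- exact: (fgen true).
- by move=> a; have [_] := fgood a.
Qed.

(** The preimage of [D] under [unjoin n] is dense open, hence contains some [\bigcap_m T b m]; along
    increasing lists above [b] the sections of these sets are dense. *)
Lemma generic_avoids z n D : generic z -> tuple_open D -> tuple_dense n D ->
  exists b, forall l, size l = n -> path lt b l -> D (map z l).
Proof.
move=> zgen oD dD.
have [b Db] := Tcofinal (seq_open_unjoin (n := n) oD) (seq_dense_unjoin dD).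
exists b => l ln bl.
have Ku := uncountable_cov Kreg.
(* The countably many dense open sections along [l] have a common point [w], which serves as the
   remaining coordinate. *)
have [|w wT] := @generic_bits R _ [set: nat] (fun m => foldl slice (T b m) (map z l)) Ku.
  by move=> m _; split; [apply: seq_open_slices; have [] := oT b m|exact: zgen].
have /= := Db (joins (map z l) w); rewrite -ln -(size_map z) unjoin_joins; apply.
by move=> m; apply/slices_joins; exact: wT.
Qed.

Definition extends (u : seq (seq bool)) (zs : seq bits) := size zs = size u /\
  forall i j, (j < size (nth [::] u i))%N -> nth zero zs i j = nth false (nth [::] u i) j.

Lemma small_nlt b : small K [set a | ~~ lt b a].
Proof.
apply: (small_sub (B := [set a | lt a b] `|` [set b])).
  move=> a /=; have [->//|->|ab] := lttri b a; first by right.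
  by left.
apply: (smallU Kreg (uncountable_cov Kreg)); first exact: ltsmall.
exact/(small_finite Kreg)/finite_set1.
Qed.

(** [W i k q] is the set of tuples covered by candidate [q] for the [k]-th cover in problem [i]; one
    sequence [g] must serve all problems. Even positions go to a countable dense set of tuples, odd
    ones to the induction hypothesis with the first coordinate fixed. *)
Lemma generic_select (Q : countType) (q0 : Q) z n U (I : set U)
    (W : U -> nat -> Q -> set (seq bits)) : generic z -> small K I ->
  (forall i k q, I i -> tuple_open (W i k q)) ->
  exists g : nat -> Q, forall i l, I i -> sorted lt l -> (size l < n)%N ->
    (forall k, exists q, W i k q (map z l)) -> exists k, W i k (g k) (map z l).
Proof.
move=> zgen; elim: n U I W => [|n IHn] U I W sI oW; first by exists (fun=> q0).
have Ku := uncountable_cov Kreg.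
pose P i l := sorted lt l /\ forall k, exists q, W i k q (map z l).
(* [p (i, u)] is a tuple of problem [i] in the cylinder of [u], whenever there is one; for each [i]
   these form a countable dense set of tuples. *)
have /choice[p pP] : forall iu : U * seq (seq bool), exists p,
    forall l, P iu.1 l -> extends iu.2 (map z l) -> P iu.1 p /\ extends iu.2 (map z p).
  move=> [i u]; have [[p [Pp up]]|np] := pselect (exists p, P i p /\ extends u (map z p)).
    by exists p.
  by exists [::] => l Pl ul; case: np; exists l.
pose D iu : set (nat -> Q) := if `[< P iu.1 (p iu) >] then
  [set g | exists k, W iu.1 k.*2 (g k) (map z (p iu))] else setT.
have [||g0 g0P] := @generic_stream R _ q0 _ (I `*` [set: seq (seq bool)]) D.
- by apply: (smallX Kreg) => //; exact: (small_countType Ku).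
- move=> iu [Ii _]; rewrite /D; case: asboolP => [[_ PW]|_]; last first.
    by split=> [c _|c m]; [exists 0%N|exists c].
  split=> [g [k gk]|g m]; first by exists k.+1 => g' gg'; exists k; rewrite -gg'.
  have [q Wq] := PW m.*2; exists (fun j => if (j < m)%N then g j else q).
    by move=> j jm; rewrite jm.
  by exists m; rewrite ltnn.
(* The second alternative makes [D' i] dense although the chosen sets cover
   only the tuples of [P i]. *)
pose D' i : set (seq bits) := [set zs | (exists k, W i k.*2 (g0 k) zs) \/
  exists m, forall zs', tuple_agree m zs zs' -> forall l, P i l -> zs' <> map z l].
have oD' i : I i -> tuple_open (D' i).
  move=> Ii zs [[k /(oW _ _ _ Ii)[m Wm]]|[m zsP]].
    by exists m => zs' /Wm ?; left; exists k.
  exists m => zs' zszs'; right; exists m => zs'' zs'zs''; apply: zsP.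
  exact: tuple_agree_trans zs'zs''.
have dD' i s : I i -> tuple_dense s (D' i).
  move=> Ii zs m szs; pose u := map (fun c => mkseq c m) zs.
  have uP zs' : tuple_agree m zs zs' <-> extends u zs'.
    split=> [[sz a]|[sz ext]].
      split=> [|k j]; first by rewrite size_map.
      have [kzs|kzs] := ltnP k (size zs); last by rewrite nth_default ?size_map.
      by rewrite (nth_map zero)// size_mkseq => jm; rewrite nth_mkseq// a.
    have szz : size zs = size zs' by rewrite sz size_map.
    split=> // k j jm; have [kzs|kzs] := ltnP k (size zs); last first.
      by rewrite !nth_default// -szz.
    by rewrite ext (nth_map zero)// ?size_mkseq// nth_mkseq.
  have [[l [Pl ul]]|nl] := pselect (exists l, P i l /\ extends u (map z l)).
    have [Pp up] := pP (i, u) l Pl ul; exists (map z (p (i, u))); first exact/uP.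
    by left; have := g0P (i, u) (conj Ii Logic.I); rewrite /D; case: asboolP.
  exists zs => //; right; exists m => zs' /uP zszs' l Pl zs'E.
  by apply: nl; exists l; rewrite -zs'E.
have /choice[b bP] : forall is_ : U * nat, exists b, I is_.1 -> forall l,
    size l = is_.2 -> path lt b l -> D' is_.1 (map z l).
  move=> [i s]; have [Ii|nIi] := pselect (I i); last first.
    have [||b _] := @Tcofinal setT; last by exists b.
      by move=> c _; exists 0%N.
    by move=> c m; exists c.
  have [b bP] := generic_avoids zgen (oD' _ Ii) (dD' i s Ii).
  by exists b.
(* The tuples not served by [g0] have a least index [a] not above the bound; these pairs [(i, a)]
   are the problems for the induction hypothesis, still fewer than [K]. *)
pose J : set (U * A) := \bigcup_(i in I) \bigcup_s (pair i @` [set a | ~~ lt (b (i, s)) a]).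
have [||g1 g1P] := IHn _ J (fun ia k q => [set zs | W ia.1 k.*2.+1 q (z ia.2 :: zs)]).
- apply: (small_bigcup Kreg) => // i _; apply: (small_bigcup Kreg) => // s _.
  exact/small_image/small_nlt.
- move=> [_ _] k q [i Ii [s _ [a _ [<- <-]]]] zs /(oW _ _ _ Ii)[m Wm].
  by exists m => zs' zszs'; apply: Wm; exact: tuple_agree_cons.
exists (fun k => if odd k then g1 k./2 else g0 k./2) => i l Ii lsort ln lW.
have [bl|] := boolP (path lt (b (i, size l)) l).
  have [[k Wk]|[m lP]] := bP (i, size l) Ii l erefl bl; last first.
    by have /(_ erefl) := lP _ (tuple_agree_refl _ _) l (conj lsort lW).
  by exists k.*2; rewrite odd_double doubleK.
case: l lsort ln lW => [//|a l] /= al ln lW; rewrite al andbT => nba.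
have [||||k Wk] := g1P (i, a) l => //.
- by exists i => //; exists (size l).+1 => //; exists a.
- exact: path_sorted al.
- by move=> k; have [q Wq] := lW k.*2.+1; exists q.
by exists k.*2.+1; rewrite /= odd_double /= uphalf_double.
Qed.

End Generic.

(** * Topological consequences *)

Lemma prod_nbhs (I : Type) (T : I -> topologicalType) (f : prod_topology T)
    (F : set_system (prod_topology T)) : Filter F ->
  (forall i (O : set (T i)), open O -> O (f i) -> F [set g | O (g i)]) ->
  nbhs f `<=` F.
Proof.
move=> FF FO; suff : F --> f by [].
apply/cvg_sup => i V [_ [[O oO <-] Of] OV].
by apply: filterS (FO i O oO Of) => g /OV.
Qed.

Lemma nbhs_agree (c : cantor_space) (V : set cantor_space) :
  nbhs c V <-> exists n, forall c' : cantor_space, agree n c c' -> V c'.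
Proof.
split=> [|[n nV]].
  apply: (prod_nbhs (F := fun V =>
    exists n, forall c' : cantor_space, agree n c c' -> V c')).
    split=> [|P Q [n nP] [m mQ]|P Q PQ [n nP]]; first by exists 0%N.
      exists (maxn n m) => c' cc'; split.
        by apply: nP; apply: agreeW cc'; exact: leq_maxl.
      by apply: mQ; apply: agreeW cc'; exact: leq_maxr.
    by exists n => c' /nP /PQ.
  by move=> i O _ Oc; exists i.+1 => c' cc'; rewrite /= -cc'.
suff : nbhs c [set c' : cantor_space | agree n c c'] by apply: filterS => c' /nV.
elim: n {nV} => [|n IHn]; first by apply: filterS filterT => c' _ i.
have cn : nbhs c [set c' : cantor_space | c' n = c n].
  apply: (@proj_continuous _ (fun _ : nat => bool) n c [set c n]).
  by rewrite nbhs_principalE.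
apply: filterS (filterI IHn cn) => c' [cc' c'n] i.
by rewrite ltnS leq_eqVlt => /predU1P[->//|]; exact: cc'.
Qed.

Lemma seq_open_open (D : set cantor_space) : seq_open D -> open D.
Proof. by move=> oD; rewrite openE => c /oD[n Dn]; apply/nbhs_agree; exists n. Qed.

Lemma open_seq_open (D : set cantor_space) : open D -> seq_open D.
Proof. by rewrite openE => oD c /oD /nbhs_agree. Qed.

Lemma nowhere_dense_seq_dense (M : set cantor_space) :
  nowhere_dense M -> seq_dense (~` closure M).
Proof.
move=> ndM c n; apply: contrapT => nc.
have : interior (closure M) c.
  apply/nbhs_agree; exists n => c' cc'; apply: contrapT => nM; apply: nc.
  by exists c'.
by rewrite ndM.
Qed.

Lemma nbhs_power (X : set cantor_space) n
    (f : prod_topology (fun _ : 'I_n => set_type X))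
    (V : set (prod_topology (fun _ : 'I_n => set_type X))) :
  nbhs f V -> exists m, forall f' : prod_topology (fun _ : 'I_n => set_type X),
    (forall i, agree m (val (f i)) (val (f' i))) -> V f'.
Proof.
pose F (V : set (prod_topology (fun _ : 'I_n => set_type X))) := exists m,
  forall f' : prod_topology (fun _ : 'I_n => set_type X),
    (forall i, agree m (val (f i)) (val (f' i))) -> V f'.
suff sub : nbhs f `<=` F by move=> fV; exact: (sub V fV).
apply: prod_nbhs.
  split=> [|P Q [k kP] [m mQ]|P Q PQ [m mP]]; first by exists 0%N.
    exists (maxn k m) => f' ff'; split.
      by apply: kP => i; apply: agreeW (ff' i); exact: leq_maxl.
    by apply: mQ => i; apply: agreeW (ff' i); exact: leq_maxr.
  by exists m => f' /mP /PQ.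
move=> i O [O' oO' OO']; rewrite -{1}OO' => O'f.
have [m mO'] := open_seq_open oO' O'f.
by exists m => f' ff'; rewrite /= -OO'; apply: mO' => j jm; exact: ff'.
Qed.

Lemma infinite_subsetsP (c : cantor_space) :
  (forall m, exists2 i, (m <= i)%N & c i) -> infinite_subsets c.
Proof.
move=> cinf /finite_seqP[s sc].
have [i si ci] := cinf (\max_(j <- s) j).+1.
have : i \in s by have : [set k | c k] i by []; rewrite sc.
by move=> si'; have := @leq_bigmax_seq _ s xpredT id i si' isT; rewrite leqNgt si.
Qed.

Lemma nth_elt_leq (c : cantor_space) n m : infinite_subsets c ->
  (nth_elt c n <= m)%N = (n < count c (iota 0 m.+1))%N.
Proof.
move=> /(@nth_eltP c n)[cn cntn]; set k := nth_elt c n in cn cntn *.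
have mono p q : (p <= q)%N -> (count c (iota 0 p) <= count c (iota 0 q))%N.
  by move=> pq; rewrite -(subnKC pq) iotaD count_cat leq_addr.
apply/idP/idP => [km|]; last first.
  by apply: contraTT; rewrite -!ltnNge ltnS => /mono; rewrite cntn.
apply: leq_trans (mono k.+1 m.+1 km).
by rewrite -[k.+1]addn1 iotaD count_cat cntn /= add0n cn addn1.
Qed.

(** Finitely many members of an increasing sequence of open sets lie in a single one, whose index is
    taken as [h n]. *)
Lemma menger_bound (Z : topologicalType) (O : nat -> nat -> set Z) : menger Z ->
  (forall n m, open (O n m)) -> (forall n m m', (m <= m')%N -> O n m `<=` O n m') ->
  (forall n p, exists m, O n m p) -> exists h, forall p, exists n, O n (h n) p.
Proof.
move=> mZ oO Omono Ocov.
have [|F Ffin Fcov] := mZ (fun n => range (O n)).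
  move=> n; split=> [_ [m _ <-]//|]; rewrite predeqE => p; split=> // _.
  by have [m Omp] := Ocov n p; exists (O n m) => //; exists m.
have /choice[h hP] : forall n, exists m, forall B, F n B -> B `<=` O n m.
  move=> n; have [/finite_seqP[s ->] Fsub] := Ffin n.
  elim: s Fsub => [|B s IHs] Fsub; first by exists 0%N.
  have [|m mP] := IHs; first by move=> C Cs; apply: Fsub; rewrite /= in_cons Cs orbT.
  have [k _ BE] : range (O n) B by apply: Fsub; rewrite /= mem_head.
  exists (maxn m k) => C /=; rewrite in_cons => /predU1P[->|/mP CO].
    by rewrite -BE; exact/Omono/leq_maxr.
  by apply: (subset_trans CO); exact/Omono/leq_maxl.
exists h => p; have : [set: Z] p by [].
by rewrite -Fcov => -[n _ [B FB Bp]]; exists n; exact: hP FB p Bp.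
Qed.

(** * The Luzin property and Rothberger powers *)

Section Conclusion.
Variables (R : realType) (A : choiceType) (lt : rel A).
Local Notation K := (cov_meager R).
Hypothesis Kreg : regular_card K.
Hypothesis ltwf : well_founded lt.
Hypothesis lttr : transitive lt.
Hypothesis lttri : forall a b, [\/ lt a b, a = b | lt b a].
Hypothesis ltsmall : forall a, small K [set b | lt b a].
Hypothesis AK : [set: A] #= K.
Variables (T : A -> nat -> set (nat -> bool)).
Hypothesis oT : forall a m, seq_open (T a m) /\ seq_dense (T a m).
Hypothesis Tcofinal :
  forall D, seq_open D -> seq_dense D -> exists a, forall c, (forall m, T a m c) -> D c.

Variable z : A -> cantor_space.
Hypothesis zgen : generic lt T z.
Hypothesis zinf : forall a, infinite_subsets (z a).

Lemma notin_eventually (D : set (nat -> bool)) : seq_open D -> seq_dense D ->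
  exists b, forall a, lt b a -> D (z a).
Proof.
move=> oD dD; pose D1 (zs : seq (nat -> bool)) := D (nth zero zs 0).
have [||b bP] := @generic_avoids R A lt Kreg T oT Tcofinal z 1 D1 zgen.
- by move=> zs /oD[n Dn]; exists n => zs' [_ zszs']; exact: Dn.
- move=> [//|c []//] n _; have [c' cc' Dc'] := dD c n; exists [:: c'] => //.
  by split=> // -[//|i]; rewrite /= !nth_nil.
by exists b => a ba; apply: (bP [:: a]) => //=; rewrite ba.
Qed.

Lemma generic_luzin : luzin K (range z).
Proof.
have nlt := small_nlt Kreg lttri ltsmall.
split=> [_ [a _ <-]//||M [N ndN ->]].
- apply: contrapT => sX.
  (* Each fibre of [z] is small, because the complement of a point is dense open; a small range
     would therefore make [A] small. *)
  have : small K [set: A].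
    apply: (small_sub (B := \bigcup_(c in range z) [set a | z a = c])).
      by move=> a _; exists (z a) => //; exists a.
    apply: (small_bigcup Kreg) => // c _.
    have [||b bP] := @notin_eventually [set c' | c' <> c].
    + move=> c' c'c; have [i ci] : exists i, c' i <> c i.
        apply: contrapT => nc; apply: c'c; apply/funext => i.
        by apply: contrapT => ci; apply: nc; exists i.
      by exists i.+1 => c'' c'c'' cE; apply: ci; rewrite c'c''// cE.
    + move=> c' n; exists (fun i => if (i < n)%N then c' i else ~~ c i).
        by move=> i iltn; rewrite iltn.
      by move=> /(congr1 (fun f => f n)); rewrite ltnn => /esym; case: (c n).
    by apply: small_sub (nlt b) => a /= zac; apply/negP => /bP; apply.
  by apply; move: AK; rewrite card_eq_le => /andP[].
- split.
    apply: card_le_trans (_ : [set: A] #<= K); last first.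
      by move: AK; rewrite card_eq_le => /andP[].
    by apply: (card_le_trans (subset_card_le (@subIsetl _ _ _))); exact: card_image_le.
  have /choice[b bP] : forall n, exists b, forall a, lt b a -> ~ N n (z a).
    move=> n; have [|b bP] := notin_eventually _ (nowhere_dense_seq_dense (ndN n)).
      by apply: open_seq_open; apply: closed_openC; exact: closed_closure.
    by exists b => a /bP ncl Na; apply: ncl; exact: subset_closure.
  apply: (small_sub (B := \bigcup_n (z @` [set a | ~~ lt (b n) a]))).
    move=> _ [[a _ <-] [n _ Nza]]; exists n => //; exists a => //=.
    by apply/negP => /bP.
  apply: (small_bigcup Kreg) => [|n _]; first exact: uncountable_cov.
  exact: small_image.
Qed.

(** Coordinates of a point of a power come in any order and with repetitions, while genericity
    concerns increasing lists of indices; sorting without duplicates mediates. *)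
Lemma increasing_list (s : seq A) : exists l,
  [/\ sorted lt l, (size l <= size s)%N & l =i s].
Proof.
pose le a b := (a == b) || lt a b.
have letot : total le.
  by move=> a b; rewrite /le; have [->|->|->] := lttri a b; rewrite ?eqxx ?orbT.
have letr : transitive le.
  move=> b a c /predU1P[->//|ab] /predU1P[<-|bc]; first by rewrite /le ab orbT.
  by rewrite /le (lttr ab bc) orbT.
exists (sort le (undup s)); split.
- have := sort_sorted letot (undup s); rewrite (sorted_pairwise letr) => lep.
  have := sort_uniq le (undup s); rewrite undup_uniq uniq_pairwise => unip.
  apply: pairwise_sorted.
  have : pairwise [rel a b | le a b && (a != b)] (sort le (undup s)).
    by rewrite pairwise_relI lep.
  by apply: sub_pairwise => a b /= /andP[/predU1P[->|//]]; rewrite eqxx.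
- by rewrite size_sort size_undup.
- by move=> a; rewrite mem_sort mem_undup.
Qed.

Lemma generic_rothberger n :
  rothberger (prod_topology (fun _ : 'I_n => set_type (range z))).
Proof.
set P := prod_topology _; move=> U Ucov.
pose tup (f : P) : seq (nat -> bool) := [seq val (f i) | i <- enum 'I_n].
(* A tuple of words is valid if its cylinder lies within one member of the [k]-th cover; selecting
   such tuples instead of open sets makes the candidates countable. *)
pose valid k u := exists B, U k B /\ forall f : P, extends u (tup f) -> B f.
have tup_valid k f : exists2 u, valid k u & extends u (tup f).
  have [Uopen UT] := Ucov k; have : [set: P] f by [].
  rewrite -UT => -[B UB Bf]; have := Uopen _ UB; rewrite openE => /(_ _ Bf).
  move=> /nbhs_power[m mP]; pose u := [seq mkseq c m | c <- tup f].
  have szt g : size (tup g) = n by rewrite size_map size_enum_ord.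
  have nthu (i : 'I_n) : nth [::] u i = mkseq (val (f i)) m.
    rewrite (nth_map zero) ?szt//.
    by rewrite (nth_map i) ?size_enum_ord// nth_ord_enum.
  have nthtup g (i : 'I_n) : nth zero (tup g) i = val (g i).
    by rewrite (nth_map i) ?size_enum_ord// nth_ord_enum.
  have szu : size u = n by rewrite size_map szt.
  exists u; last first.
    split=> [|i j]; first by rewrite szu szt.
    have [iltn|ni] := ltnP i n; last by rewrite nth_default ?szu.
    rewrite (nthu (Ordinal iltn)) (nthtup f (Ordinal iltn)) size_mkseq => jm.
    by rewrite nth_mkseq.
  exists B; split=> // g [_ ext]; apply: mP => i j jm.
  have := ext i j; rewrite nthu nthtup size_mkseq => /(_ jm) ->.
  by rewrite nth_mkseq.
(* [tau] records how the coordinates are read off an increasing list. There are only countably many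
   patterns, so they form a small set of problems. *)
pose W (tau : seq nat) k u (zs : seq (nat -> bool)) :=
  valid k u /\ extends u [seq nth zero zs i | i <- tau].
have [||g gP] := @generic_select R A lt Kreg lttri ltsmall T oT Tcofinal _ [::]
    z n.+1 _ [set: seq nat] W zgen.
- exact: (small_countType (uncountable_cov Kreg)).
- move=> tau k u _ zs [vu [sz ext]]; exists (\max_(v <- u) size v) => zs' [_ zszs'].
  split=> //; split=> [|i j]; first by rewrite -sz !size_map.
  have [iltu|ui] := ltnP i (size u); last by rewrite nth_default.
  move=> jlt; rewrite -ext//.
  have itau : (i < size tau)%N by move: iltu; rewrite -sz size_map.
  rewrite !(nth_map 0%N)//; apply/esym/zszs'; apply: leq_trans jlt _.
  exact: (@leq_bigmax_seq _ u xpredT size _ (mem_nth _ iltu) isT).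
have /choice[al alP] : forall c : range z, exists a, z a = val c.
  by move=> c; have [a _ ac] := set_valP c; exists a.
have covered (f : P) : exists k, valid k (g k) /\ extends (g k) (tup f).
  have [l [lsort lsz ls]] := increasing_list [seq al (f i) | i <- enum 'I_n].
  pose tau := [seq index (al (f i)) l | i <- enum 'I_n].
  have tauE : [seq nth zero (map z l) i | i <- tau] = tup f.
    rewrite -map_comp; apply: eq_map => i /=; set a := al (f i).
    have al' : a \in l by rewrite ls map_f// mem_enum.
    by rewrite (nth_map a) ?index_mem// nth_index// alP.
  have [||k [vk]] := gP tau l Logic.I lsort.
  - by rewrite ltnS (leq_trans lsz)// size_map size_enum_ord.
  - by move=> k; have [u vu fu] := tup_valid k f; exists u; split=> //; rewrite tauE.
  by rewrite tauE => fk; exists k.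
have [f0 _] : exists f : P, True.
  have [a0 _] : [set: A] !=set0.
    apply/set0P; apply/eqP => A0; have [Kinf _] := Kreg; apply: Kinf.
    move: AK; rewrite A0 card_eq_sym card_eq0 => /eqP->; exact: finite_set0.
  by exists (fun=> @exist _ _ (z a0) (mem_set (imageT z a0))).
(* Where [g k] is not valid, any member of the cover will do; [f0] shows that there is one. *)
have /choice[V VP] : forall k, exists B, U k B /\
    (valid k (g k) -> forall f : P, extends (g k) (tup f) -> B f).
  move=> k; have [[B [UB BP]]|nv] := pselect (valid k (g k)); first by exists B.
  by have [_ [B [UB _]] _] := tup_valid k f0; exists B; split=> // /nv.
exists V => [k|]; first by have [] := VP k.
rewrite predeqE => f; split=> // _; have [k [vk fk]] := covered f.
by exists k => //; have [_] := VP k; exact.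
Qed.

End Conclusion.

(** * Failure of the Menger property and the final assembly *)

(** For each [n], the sets of pairs whose [n]-th elements are both at most [m] form an increasing
    open cover. The Menger property would bound every pair at infinitely many [n] by a fixed
    function, against the pairs assumed to dominate. *)
Lemma not_menger_prod (X Y : set cantor_space) :
  X `<=` infinite_subsets -> Y `<=` infinite_subsets ->
  (forall f : nat -> nat, {homo f : m n / (m <= n)%N} -> exists x y N,
    [/\ X x, Y y &
      forall n, (N <= n)%N -> (f n <= maxn (nth_elt x n) (nth_elt y n))%N]) ->
  ~ menger (set_type X * set_type Y)%type.
Proof.
move=> Xinf Yinf XYdom mXY.
pose low n m : set cantor_space :=
  [set c : cantor_space | (n < count c (iota 0 m.+1))%N].
have openlow n m : open (low n m).
  apply: seq_open_open => c cnm; exists m.+1 => c' cc'.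
  suff cE : count c (iota 0 m.+1) = count c' (iota 0 m.+1).
    by move: cnm; rewrite /low /mkset cE.
  by apply: eq_in_count => i; rewrite mem_iota => im; exact: cc'.
pose O n m : set (set_type X * set_type Y)%type :=
  [set p | low n m (val p.1) /\ low n m (val p.2)].
have openO n m : open (O n m).
  apply: openI.
    apply: (@open_comp _ _ (fun p : (set_type X * set_type Y)%type => val p.1)) => // p _.
    by apply: continuous_comp; [exact: cvg_fst|exact: initial_continuous].
  apply: (@open_comp _ _ (fun p : (set_type X * set_type Y)%type => val p.2)) => // p _.
  by apply: continuous_comp; [exact: cvg_snd|exact: initial_continuous].
have lowE (c : cantor_space) n m : infinite_subsets c ->
    low n m c <-> (nth_elt c n <= m)%N.
  by move=> cinf; rewrite nth_elt_leq.
have OE n m (p : (set_type X * set_type Y)%type) :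
    O n m p <-> (maxn (nth_elt (val p.1) n) (nth_elt (val p.2) n) <= m)%N.
  have p1 : infinite_subsets (val p.1) by exact/Xinf/set_valP.
  have p2 : infinite_subsets (val p.2) by exact/Yinf/set_valP.
  rewrite geq_max; split=> [[/(lowE _ _ _ p1)-> /(lowE _ _ _ p2)->]//|/andP[? ?]].
  by split; exact/lowE.
(* Applying the Menger property to every tail of the sequence of covers bounds
   each pair at infinitely many [n], not just at one. *)
have /choice[h hP] : forall i, exists h, forall p, exists n, O (i + n)%N (h n) p.
  move=> i; apply: (menger_bound (O := fun n m => O (i + n)%N m)) => //.
    by move=> n m m' mm' p /OE pm; apply/OE; exact: leq_trans mm'.
  by move=> n p; eexists; apply/OE; exact: leqnn.
(* [H n] majorizes the bounds at [n] from all tails starting at or before [n], and [f] is monotone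
   and exceeds [H] everywhere. The tail starting at [N] then contradicts the domination valid from
   [N] on. *)
pose H n := \max_(i < n.+1) h i (n - i)%N.
pose f n := \max_(j < n.+1) (H j).+1.
have [m n mn|x [y [N [Xx Yy fN]]]] := XYdom f.
  apply/bigmax_leqP => j _; have jn : (j < n.+1)%N by apply: leq_trans (ltn_ord j) _.
  exact: (leq_bigmax (Ordinal jn)).
pose p : (set_type X * set_type Y)%type :=
  (@exist _ _ x (mem_set Xx), @exist _ _ y (mem_set Yy)).
have [n /OE /=] := hP N p; apply/negP; rewrite -ltnNge.
apply: leq_trans (fN _ (leq_addr n N)).
apply: (@leq_trans (H (N + n)%N).+1); last exact: (leq_bigmax (@Ordinal _ (N + n) _)).
have NNn : (N < (N + n).+1)%N by rewrite ltnS leq_addr.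
pose F (i : 'I_(N + n).+1) := h i (N + n - i)%N.
by rewrite ltnS; have := leq_bigmax (F := F) (Ordinal NNn); rewrite /F /= addKn.
Qed.

Theorem theorem2p1 (R : realType)
    (cov_eq_cof : cov_meager R #= cof_meager R)
    (cov_regular : regular_card (cov_meager R)) :
  exists X Y : set cantor_space,
    [/\ luzin (cov_meager R) X, luzin (cov_meager R) Y &
    [/\ (forall n : nat, rothberger (prod_topology (fun _ : 'I_n => set_type X))) /\
        (forall n : nat, rothberger (prod_topology (fun _ : 'I_n => set_type Y))),
        ~ menger (set_type X * set_type Y)%type &
        two_dominating (X `|` Y)]].
Proof.
have [A [lt [ltwf lttr lttri ltsmall AK]]] := initial_index (cov_meager R).
have [T [oT Tcof]] := cofinal_dense cov_eq_cof AK.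
have [d ddom] := dominating_of_cofinal oT Tcof.
have [x [y [xgen ygen xyP]]] := generic_pairs cov_regular ltwf lttr ltsmall d oT.
have xinf a : infinite_subsets (x a) by have [? _ _] := xyP a; exact: infinite_subsetsP.
have yinf a : infinite_subsets (y a) by have [_ ? _] := xyP a; exact: infinite_subsetsP.
have dxy a n : (d a n <= maxn (nth_elt (x a) n) (nth_elt (y a) n))%N.
  have [_ _ /(_ (nth_elt (x a) n) (nth_elt (y a) n))] := xyP a.
  have [-> ->] := nth_eltP n (xinf a); have [-> ->] := nth_eltP n (yinf a).
  exact.
pose X : set cantor_space := range x; pose Y : set cantor_space := range y.
have dom (f : nat -> nat) : {homo f : m n / (m <= n)%N} -> exists a N,
    forall n, (N <= n)%N -> (f n <= maxn (nth_elt (x a) n) (nth_elt (y a) n))%N.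
  move=> /ddom[a [N fd]]; exists a, N => n /fd fn; exact: leq_trans fn (dxy a n).
exists X, Y; split.
- exact: (generic_luzin (T := T) cov_regular lttri ltsmall AK oT Tcof).
- exact: (generic_luzin (T := T) cov_regular lttri ltsmall AK oT Tcof).
split.
- by split=> n;
    exact: (generic_rothberger (T := T) cov_regular lttr lttri ltsmall AK oT Tcof).
- apply: not_menger_prod => [_ [a _ <-]|_ [a _ <-]|f /dom[a [N fN]]] //.
  by exists (x a), (y a), N; split=> //; exists a.
- move=> u uinf; have [|a [N uN]] := dom (nth_elt u).
    move=> m n; rewrite leq_eqVlt => /predU1P[->//|mn].
    exact/ltnW/nth_elt_mono.
  exists (max_subset (x a) (y a)).
    by exists (x a); [left; exists a|exists (y a); [right; exists a|]].
  apply: (@sub_finite_set _ _ `I_N); last exact: finite_II.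
  move=> n /=; rewrite nth_elt_max// ltnNge [(n < N)%N]ltnNge.
  by apply: contra => /uN.
Qed.
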